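(* Let $G$ be a connected $\{P_k, K_m\}$-free graph with minimum degree $\delta(G)\geq \delta_k$ and $|V(G)|=n\geq k$. Then one of the following holds: (1) $G$ is a subgraph of $H \vee I_{n-\delta_k}$ if $k$ is even, and of $H \vee ( I_{n-\delta_k-2} \cup K_2)$ if $k$ is odd, for some $K_{m-1}$-free graph $H$ on $\delta_k$ vertices; (2) $m\ge \delta_k+2$ and $G$ is isomorphic to $G_1(n,k)$, to $G_2(n,k)$, or to a graph $G_3(n,k)$; (3) $k=7$, $m\geq 4$ and $G\cong G_4(n)$ or $G\cong G_5(n)$; (4) $k=9$, $m\geq 4$ and $G\cong I_2 \vee \frac{n-2}{2} K_2$, or $k=9$, $m\geq 5$ and $G\cong K_2 \vee \frac{n-2}{2} K_2$.
   Context: All graphs are finite and simple. $K_n$, $P_n$, $I_n$ denote the complete graph, the path, and the edgeless graph on $n$ vertices; $K_{1,s}$ is the star with $s$ leaves. For disjoint graphs $G,H$: $G\cup H$ is their disjoint union, $tG$ is the disjoint union of $t$ copies of $G$, and $G\vee H$ is obtained from $G\cup H$ by adding all edges between $V(G)$ and $V(H)$. A graph is $\mathcal H$-free if it contains no member of $\mathcal H$ as a subgraph. A block is a maximal connected subgraph without a cut vertex. Let $\delta_k=\lfloor k/2\rfloor-1$. For $\delta_k\le m-2$: $G_1(n,k)=K_1\vee tK_{\delta_k}$ where $n=1+t\delta_k$, $t\ge1$ (the vertex of $K_1$ is its centre); for $k$ odd, $G_2(n,k)$ is the $n$-vertex graph obtained from $G_1(n_1,k)$ and $G_1(n_2,k)$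 (disjoint) by joining their centres by an edge, where $n=n_1+n_2$; for $k$ odd, a graph $G_3(n,k)$ is any $n$-vertex graph obtained from $G_1(n-1,k)$ by replacing one block $K_{\delta_k+1}$ by a $K_m$-free block $B$ of order $\delta_k+2$ (sharing the centre as its cut vertex) such that the resulting graph has minimum degree at least $\delta_k$. $G_4(n)$ (resp. $G_5(n)$) is the $n$-vertex graph obtained from disjoint $G_1(n_1,7)$ and $K_{1,n_2-2}$ by joining the centre of $G_1(n_1,7)$ to all leaves of $K_{1,n_2-2}$ (resp. to all vertices of $K_{1,n_2-2}$), where $n_2\ge4$ and $n=n_1+n_2-1$. *)

(* Defs.v *)
From mathcomp Require Import all_boot.
Set Implicit Arguments. Unset Strict Implicit. Unset Printing Implicit Defensive.

Definition simple_graph (T : finType) (e : rel T) : Prop :=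
  symmetric e /\ irreflexive e.

Definition connectedg (T : finType) (e : rel T) : Prop :=
  forall x y : T, connect e x y.

Definition deg (T : finType) (e : rel T) (x : T) : nat := #|[set y | e x y]|.
Definition mindeg_ge (T : finType) (e : rel T) (d : nat) : Prop :=
  forall x : T, d <= deg e x.

Definition has_Pk (T : finType) (e : rel T) (k : nat) : Prop :=
  exists s : seq T, [/\ size s = k, uniq s & sorted e s].

Definition has_Km (T : finType) (e : rel T) (m : nat) : Prop :=
  exists S : {set T}, #|S| = m /\ {in S &, forall x y, x != y -> e x y}.

Definition subgraph_of (T1 T2 : finType) (e1 : rel T1) (e2 : rel T2) : Prop :=
  exists f : T1 -> T2, injective f /\ forall x y, e1 x y -> e2 (f x) (f y).

Definition isomorphic (T1 T2 : finType) (e1 : rel T1) (e2 : rel T2) : Prop :=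
  exists f : T1 -> T2, bijective f /\ forall x y, e2 (f x) (f y) = e1 x y.

Definition delta (k : nat) : nat := k./2 - 1.

Definition emptyg (n : nat) : rel 'I_n := fun _ _ => false.
Definition completeg (n : nat) : rel 'I_n := fun x y => x != y.
Arguments emptyg n : clear implicits.
Arguments completeg n : clear implicits.

Definition uniong (T1 T2 : finType) (e1 : rel T1) (e2 : rel T2) : rel (T1 + T2)%type :=
  fun x y => match x, y with
  | inl a, inl b => e1 a b
  | inr a, inr b => e2 a b
  | _, _ => false
  end.

Definition joing (T1 T2 : finType) (e1 : rel T1) (e2 : rel T2) : rel (T1 + T2)%type :=
  fun x y => match x, y with
  | inl a, inl b => e1 a b
  | inr a, inr b => e2 a b
  | _, _ => true
  end.

Definition copiesg (t : nat) (T : finType) (e : rel T) : rel ('I_t * T)%type :=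
  fun x y => (x.1 == y.1) && e x.2 y.2.
Arguments copiesg t [T] e.

Definition starg (s : nat) : rel (option 'I_s) :=
  fun x y => match x, y with
  | None, Some _ | Some _, None => true
  | _, _ => false
  end.
Arguments starg s : clear implicits.

Definition G1T (t d : nat) : finType := ('I_1 + 'I_t * 'I_d)%type.
Definition G1g (t d : nat) : rel (G1T t d) :=
  joing (completeg 1) (copiesg t (completeg d)).
Definition G1c (t d : nat) : G1T t d := inl ord0.
Arguments G1g t d : clear implicits.
Arguments G1c t d : clear implicits.

Definition G2g (t1 t2 d : nat) : rel (G1T t1 d + G1T t2 d)%type :=
  fun x y => uniong (G1g t1 d) (G1g t2 d) x y
    || ((x == inl (G1c t1 d)) && (y == inr (G1c t2 d)))
    || ((x == inr (G1c t2 d)) && (y == inl (G1c t1 d))).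

Arguments G2g t1 t2 d : clear implicits.

Definition avoid (T : finType) (e : rel T) (v : T) : rel T :=
  fun a b => [&& e a b, a != v & b != v].
Definition no_cut_vertex (T : finType) (e : rel T) : Prop :=
  forall v x y : T, x != v -> y != v -> connect (avoid e v) x y.

(* G_3 candidate: centre None, t remaining blocks K_{d+1} (the copies of K_d
   joined to the centre), and a block B on d+2 vertices (vertex set
   option 'I_(d+1), where None is identified with the centre). *)
Definition G3T (t d : nat) : finType := option (('I_t * 'I_d) + 'I_d.+1)%type.
Definition G3g (t d : nat) (B : rel (option 'I_d.+1)) : rel (G3T t d) :=
  fun x y => match x, y with
  | None, None => false
  | None, Some (inl _) | Some (inl _), None => true
  | None, Some (inr b) => B None (Some b)
  | Some (inr a), None => B (Some a) None
  | Some (inl (i, a)), Some (inl (j, b)) => (i == j) && (a != b)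
  | Some (inr a), Some (inr b) => B (Some a) (Some b)
  | _, _ => false
  end.
Arguments G3g t [d] B.

Definition isG1 (T : finType) (e : rel T) (n k : nat) : Prop :=
  exists t, [/\ 1 <= t, n = 1 + t * delta k & isomorphic e (G1g t (delta k))].

Definition isG2 (T : finType) (e : rel T) (n k : nat) : Prop :=
  exists t1 t2, [/\ 1 <= t1, 1 <= t2,
    n = (1 + t1 * delta k) + (1 + t2 * delta k)
    & isomorphic e (G2g t1 t2 (delta k))].

(* G is (isomorphic to) a graph G_3(n,k): G_1(n-1,k) = K_1 \/ (t+1) K_d with
   one block K_{d+1} replaced by a K_m-free block B of order d+2 through the
   centre, such that the result has minimum degree >= d. *)
Definition isG3 (T : finType) (e : rel T) (n k m : nat) : Prop :=
  exists t (B : rel (option 'I_(delta k).+1)),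
    [/\ n - 1 = 1 + t.+1 * delta k,
        [/\ simple_graph B, connectedg B, no_cut_vertex B & ~ has_Km B m],
        mindeg_ge (G3g t B) (delta k)
      & isomorphic e (G3g t B)].

(* G_4(n), G_5(n): G_1(n1,7) (d = 2) and a star K_{1,s}, s = n2 - 2 *)
Definition G45T (t s : nat) : finType := (G1T t 2 + option 'I_s)%type.
Definition G4g (t s : nat) : rel (G45T t s) :=
  fun x y => uniong (G1g t 2) (starg s) x y
    || match x, y with
       | inl a, inr (Some _) | inr (Some _), inl a => a == G1c t 2
       | _, _ => false
       end.
Definition G5g (t s : nat) : rel (G45T t s) :=
  fun x y => uniong (G1g t 2) (starg s) x y
    || match x, y with
       | inl a, inr _ | inr _, inl a => a == G1c t 2
       | _, _ => false
       end.

Arguments G4g t s : clear implicits.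
Arguments G5g t s : clear implicits.

Definition isG4 (T : finType) (e : rel T) (n : nat) : Prop :=
  exists t n1 n2, [/\ 1 <= t, n1 = 1 + t * 2, 4 <= n2, n = n1 + n2 - 1
    & isomorphic e (G4g t (n2 - 2))].
Definition isG5 (T : finType) (e : rel T) (n : nat) : Prop :=
  exists t n1 n2, [/\ 1 <= t, n1 = 1 + t * 2, 4 <= n2, n = n1 + n2 - 1
    & isomorphic e (G5g t (n2 - 2))].

(* Main.v *)
Require Import Defs.
From Stdlib Require Import Classical.
From mathcomp Require Import all_boot zify.
Set Implicit Arguments. Unset Strict Implicit. Unset Printing Implicit Defensive.

(** With d = delta k, let p < k <= n be the order of a longest path v_0 .. v_(p-1).
    The sets A = {i | v_0 ~ v_(i+1)} and B = {i | v_(p-1) ~ v_i} are disjoint (otherwise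
    a spanning cycle of the path could be prolonged), so 2d < p <= 2d + 2, and at most one
    index is in neither set.
    - If some element of B precedes some element of A, a closest such pair yields a cycle
      of order p - 1, or one of order 2d missing an edge of the path (p = 2d + 2). In the
      first case all vertices off the cycle have the same d neighbours, which are spread
      over the cycle; exchanging cycle vertices with outer ones gives case (1). In the
      second case counting the neighbours of the edge on the cycle forces d = 3 and a
      hexagon with two opposite hubs, which is case (4).
    - If every longest path has A before B, it splits at a vertex c into two arms whose end
      neighbourhoods are confined to their own side. An arm of order d must be a clique
      with no outer neighbour, whence G_1 and G_2; an arm of order d + 1 closing up
      at c gives G_3, except for d = 2 where one inner vertex may have further neighbours,
      giving G_4 and G_5. *)

(** * Paths and cycles *)

(** Once [d > 0], [k = d.*2.+2 + odd k], so p is [d.*2.+1], or [d.*2.+2] with k odd: this is where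
    the parity split of the conclusion comes from. The structure depends on d and p only, so k and m
    stay out of [extremal]. K_m-freeness enters through explicit cliques: a vertex joined to all of
    X makes H K_(m-1)-free, and every exceptional shape contains a clique that bounds m from below.

    The obstacle is that one longest path says little about the rest of the graph. Three devices
    reach it. A vertex or an edge off a cycle is exchanged with a stretch of the cycle, so that
    cycle vertices become outer ones and fall under the same lemmas. An arm is rearranged within
    itself, which gives another longest path with another end; this is why absence of crossings is
    asked of every longest path. Finally, a set attached to the rest only at c must contain a whole
    pendant K_d when paths from c into it are short, so by connectedness no vertex can escape the
    description. *)

Definition gpath (T : finType) (e : rel T) (s : seq T) := uniq s && sorted e s.

(** Degenerate cases count as cycles: the empty sequence and, for a symmetric relation, the two ends
    of an edge. *)
Definition gcycle (T : finType) (e : rel T) (s : seq T) := uniq s && cycle e s.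

(* The path rev u ++ c :: w seen from its inner vertex c. *)
Definition arms (T : finType) (e : rel T) (c : T) (u w : seq T) :=
  [&& path e c u, path e c w & uniq (c :: u ++ w)].

Record extremal (T : finType) (e : rel T) (d p : nat) : Prop := Extremal {
  ex_sym : symmetric e;
  ex_irr : irreflexive e;
  ex_conn : connectedg e;
  ex_deg : mindeg_ge e d;
  ex_pos : 0 < d;
  ex_max : forall s, gpath e s -> size s <= p;
  ex_card : p < #|T|;
  ex_path : exists s, gpath e s /\ size s = p
}.

Section Paths.
Variables (T : finType) (e : rel T).
Hypothesis e_sym : symmetric e.

Lemma path_flip x s : path (fun z => e^~ z) x s = path e x s.
Proof. by apply: eq_path => a b; rewrite e_sym. Qed.

Lemma sorted_pivot u c w : sorted e (rev u ++ c :: w) = path e c u && path e c w.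
Proof.
rewrite -cat_rcons -rev_cons.
case: (lastP u) => [|u' z]; first by [].
rewrite -rcons_cons rev_rcons /= cat_path; congr (_ && _).
  by rewrite -(path_flip c (rcons u' z)) -(rev_path e) last_rcons belast_rcons.
by rewrite rev_cons last_rcons.
Qed.

Lemma gpath_pivot u c w : gpath e (rev u ++ c :: w) = arms e c u w.
Proof.
rewrite /gpath /arms sorted_pivot andbC -andbA.
congr [&& _, _ & _].
apply: perm_uniq; rewrite perm_sym -cat1s perm_catCA perm_cat2r.
by rewrite perm_sym perm_rev.
Qed.

Lemma armsC c u w : arms e c u w = arms e c w u.
Proof.
rewrite /arms andbCA; congr [&& _, _ & _].
by apply: perm_uniq; rewrite perm_cons perm_catC.
Qed.

Lemma armsP c u w : reflect
  [/\ path e c u, path e c w, uniq (c :: u), uniq (c :: w) & {in u, forall x, x \notin w}]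
  (arms e c u w).
Proof.
rewrite /arms /= cat_uniq mem_cat negb_or.
apply: (iffP and3P) => -[pu pw].
  case/and4P => /andP[-> ->] -> /hasPn h ->; split=> // x xu.
  by apply: contraL xu => /h.
case/andP=> -> -> /andP[-> ->] h; split=> //=; rewrite andbT.
by apply/hasPn => x; apply: contraL => /h.
Qed.

Lemma gpath_cons x s : gpath e (x :: s) = path e x s && uniq (x :: s).
Proof. by rewrite /gpath andbC. Qed.

Lemma rev_path_last x y s : path e x s -> last x s = y ->
  exists s', [/\ path e y s', perm_eq (y :: s') (x :: s) & last y s' = x].
Proof.
move=> xs <-; exists (rev (belast x s)); split.
- by rewrite rev_path path_flip.
- by rewrite -rev_rcons -lastI perm_rev.
- by case: s xs => //= z s _; rewrite rev_cons last_rcons.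
Qed.

Lemma gcycle_rot c s : gcycle e s -> c \in s ->
  exists r, [/\ path e c r, perm_eq (c :: r) s & r <> [::] -> head c r = next s c
      /\ e (last c r) c].
Proof.
move=> /andP[Us Cs] cs; have [i r Er] := rot_to cs.
have Pr : perm_eq (c :: r) s by rewrite -Er perm_rot.
move: Cs; rewrite -(rot_cycle i) Er /= rcons_path => /andP[cr lr].
exists r; split => // r0; split => //.
by rewrite -(next_rot i) // Er; case: (r) r0 => //= z r' _; rewrite eqxx.
Qed.

(** Opened at c and run backwards, the cycle ends at the successor of c. Vertices inserted between c
    and its successor can then close it up again. *)
Lemma gcycle_span c s : gcycle e s -> c \in s ->
  exists r, [/\ path e c r, perm_eq (c :: r) s & last c r = next s c].
Proof.
move=> Gs cs; have [r [cr Pr Hr]] := gcycle_rot Gs cs.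
case: r cr Pr Hr => [|y r] cr Pr Hr.
  exists [::]; split=> //.
  by move/perm_size: Pr; case: (s) cs => [|a [|b l]] //=; rewrite inE => /eqP ->; rewrite eqxx.
have {Hr} [/= Hn Hl] := Hr (fun h => ltac:(by [])).
have [s' [H1 H2 H3]] := @rev_path_last y (last y r) r (proj2 (andP cr)) erefl.
exists (last y r :: s'); split=> //=.
- by rewrite e_sym Hl.
- by apply: perm_trans Pr; rewrite perm_cons.
- by rewrite H3.
Qed.

(** The backward run stopped one vertex earlier: the successor of c is left out, and an outside
    vertex or edge can take its place. This is the exchange step. *)
Lemma gcycle_span2 c s : gcycle e s -> c \in s -> 1 < size s ->
  exists r, [/\ path e c r, perm_eq (next s c :: c :: r) s
              & last c r = next s (next s c)].
Proof.
move=> /andP[Us Cs] cs s3; have [i r Er] := rot_to cs.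
have Pr : perm_eq (c :: r) s by rewrite -Er perm_rot.
have Hn z : next s z = next (c :: r) z by rewrite -Er next_rot.
move: Cs; rewrite !Hn -(rot_cycle i) Er /= rcons_path => /andP[cr lr].
case: r {Hn} Er Pr cr lr => [|y r] Er Pr cr lr; first by move/perm_size: Pr s3 => /= <-.
have yc : (y == c) = false.
  have : uniq [:: c, y & r] by rewrite (perm_uniq Pr).
  by move=> /= /andP[]; rewrite inE negb_or eq_sym => /andP[/negPf].
case: r Er Pr cr lr => [|z r] Er Pr cr lr; rewrite /= !eqxx yc ?eqxx.
  by exists [::]; rewrite /= -(permPr Pr) (permPl (permEl (perm_catC [:: y] [:: c]))).
move: cr => /= /and3P[cy yz zr].
have [s' [H1 H2 H3]] := rev_path_last zr erefl.
exists (last z r :: s'); split=> //=.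
- by rewrite e_sym lr.
- have h := perm_catCA [:: y] [:: c] (last z r :: s').
  by apply: perm_trans Pr; rewrite [X in is_true X]h /= !perm_cons.
Qed.
End Paths.

Section Basics.
Variables (T : finType) (e : rel T) (d p : nat).
Hypothesis G : extremal e d p.
Let e_sym := ex_sym G.
Let e_irr := ex_irr G.

Lemma arms_bound c u w : arms e c u w -> size u + size w < p.
Proof.
rewrite -gpath_pivot // => /(ex_max G).
by rewrite size_cat size_rev /= addnS.
Qed.

Lemma edge_out (A : {set T}) x z : x \in A -> z \notin A ->
  exists a b, [/\ a \in A, b \notin A & e a b].
Proof.
move=> xA zA.
have [/existsP[a /existsP[b /and3P[]]]|/existsPn H] :=
  boolP [exists a, exists b, [&& a \in A, b \notin A & e a b]]; first by exists a, b.
have clA : closed e A.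
  apply: intro_closed; first exact: sym_connect_sym.
  move=> a b ab aA; apply/negPn/negP => bA.
  by have /existsPn/(_ b) := H a; rewrite aA bA ab.
by move: zA; rewrite -(closed_connect clA (ex_conn G x z)) xA.
Qed.

Lemma longest_head x s y : gpath e (x :: s) -> size s = p.-1 -> e x y -> y \in x :: s.
Proof.
move=> Gs sz xy; apply/negPn/negP => ys.
have : gpath e (y :: x :: s) by rewrite /gpath cons_uniq ys /= e_sym xy.
by move/(ex_max G) => /=; rewrite sz; move: (ex_max G Gs) => /=; lia.
Qed.

Lemma longest_arms c u w y : arms e c u w -> size u + size w = p.-1 ->
  e (last c w) y -> y \in c :: u ++ w.
Proof.
move=> A sz ly.
have mE : rev w ++ c :: u =i c :: u ++ w.
  by move=> z; rewrite mem_cat mem_rev !inE mem_cat orbC -orbA.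
have : gpath e (rev w ++ c :: u) by rewrite gpath_pivot // armsC.
rewrite -mE; move: ly; case: (lastP w) sz => [|w' z] sz.
  by rewrite /= => cy /(longest_head)-> //; move: sz => /=; rewrite addn0.
rewrite last_rcons rev_rcons cat_cons => zy /longest_head -> //.
by rewrite size_cat size_rev /= -sz size_rcons; lia.
Qed.

(** The cycle has at most p vertices and the graph has more, so by connectedness an edge leaves the
    cycle; opened at that edge, the cycle yields a path with one more vertex. *)
Lemma gcycle_bound s : gcycle e s -> 0 < size s -> size s < p.
Proof.
move=> Gs s0.
have [Us _] := andP Gs.
have Gp : size s <= p.
  case: s s0 Gs Us => // a s _ Gs Us.
  have [r [ar Pr _]] := gcycle_rot Gs (mem_head a s).
  rewrite -(perm_size Pr); apply: (ex_max G).
  by rewrite gpath_cons ar (perm_uniq Pr).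
have [z zs] : exists z, z \notin s.
  apply/existsP; rewrite -negb_forall; apply/negP => /forallP H.
  have : #|T| <= #|s| by apply/subset_leq_card/subsetP => x _; exact: H.
  by move: (ex_card G) (card_size s); lia.
have [x xs] : exists x, x \in s by case: (s) s0 => // a l _; exists a; rewrite mem_head.
have [||a [b []]] := @edge_out [set y in s] x z; rewrite ?inE //.
move=> sa sb ab.
have [r [ar Pr _]] := gcycle_rot Gs sa.
have : arms e a [:: b] r.
  have := sb; rewrite -(perm_mem Pr) inE negb_or => /andP[ba br].
  have /= /andP[ar' Ur] : uniq (a :: r) by rewrite (perm_uniq Pr).
  by rewrite /arms /= ab ar inE negb_or eq_sym ba ar' br.
by move/arms_bound; rewrite /= -(perm_size Pr) /=; lia.
Qed.

Lemma nbrs_size z r : z \in r -> (forall y, e z y -> y \in r) -> d < size r.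
Proof.
move=> zr H; apply: leq_ltn_trans (ex_deg G z) _.
apply: leq_trans (card_size r); rewrite /deg.
apply: proper_card; apply/properP; split; first by apply/subsetP => y; rewrite inE => /H.
by exists z; rewrite // inE e_irr.
Qed.

(** The neighbours of z and the vertices of s, among them z itself, are disjoint subsets of r. This
    count lies behind every claim that an end vertex sees its whole arm. *)
Lemma nbrs_missing z r s : uniq s -> {subset s <= r} -> z \in s ->
  (forall y, e z y -> y \in r) -> (forall y, y \in s -> ~~ e z y) -> d + size s <= size r.
Proof.
move=> Us sr zs H Hs.
apply: leq_trans (card_size r); apply: leq_trans (_ : #|[set y | e z y]| + #|s| <= _).
  by rewrite (card_uniqP Us) leq_add2r (ex_deg G).
rewrite -[#|s|](cardsE (mem s)) -cardsUI.
rewrite (_ : _ :&: _ = set0) ?cards0 ?addn0; last first.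
  by apply/setP => y; rewrite !inE andbC; apply/negP => /andP[/Hs/negP].
by apply/subset_leq_card/subsetP => y; rewrite !inE => /orP[/H|/sr].
Qed.

Lemma nbrs_full z r : z \in r -> (forall y, e z y -> y \in r) -> size r = d.+1 ->
  forall y, y \in r -> y != z -> e z y.
Proof.
move=> zr H sz y yr yz; apply/negPn/negP => zy.
have := @nbrs_missing z r [:: z; y]; rewrite sz /= !inE eqxx eq_sym (negPf yz) => /(_ isT).
suff /[swap]/[apply] : {subset [:: z; y] <= r}.
  move/(_ isT H); suff h : forall v, v \in [:: z; y] -> ~~ e z v by move/(_ h); lia.
  by move=> v; rewrite !inE => /orP[]/eqP->; rewrite ?e_irr.
by move=> v; rewrite !inE => /orP[]/eqP->.
Qed.

End Basics.

Section CrossCycle.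
Variables (T : finType) (e : rel T).
Hypothesis e_sym : symmetric e.

(** The cycle runs along [x :: a], jumps to [last y b], returns to y and closes at x; only [mid] is
    left out. *)
Lemma cross_cycle x a mid y b : gpath e ((x :: a) ++ mid ++ y :: b) ->
  e x y -> e (last y b) (last x a) -> gcycle e ((x :: a) ++ rev (y :: b)).
Proof.
rewrite /gpath /gcycle => /andP[U S] xy ll.
have Us : uniq ((x :: a) ++ y :: b).
  move: U; rewrite !cat_uniq => /and3P[-> /hasPn h /and3P[_ _ ->]]; rewrite andbT.
  by apply/hasPn => z zyb; apply: h; rewrite mem_cat zyb orbT.
apply/andP; split.
  by rewrite (perm_uniq (_ : perm_eq _ ((x :: a) ++ y :: b))) // perm_cat2l perm_rev.
have xa : path e x a by move: S => /=; rewrite cat_path => /andP[].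
have yb : path e y b.
  by move: S => /=; rewrite !cat_path /= => /and4P[].
rewrite (lastI y b) rev_rcons /= rcons_path cat_path xa /= e_sym ll rev_path path_flip // yb /=.
rewrite last_cat /= (_ : last _ _ = y) 1?e_sym //.
by case: (b) => //= z b'; rewrite rev_cons last_rcons.
Qed.
End CrossCycle.

(** * Ends of longest paths *)

(* A lies before B on every longest path. *)
Definition noncrossing (T : finType) (e : rel T) (p : nat) :=
  forall x a y b z, gpath e (x :: a ++ y :: b) -> size (x :: a ++ y :: b) = p ->
    e x y -> e (last y b) z -> z \in y :: b.

(** Indices are shifted: [nth x t j] is v_(j+1), so the middle piece is v_(i+1), ..., v_j, of length
    j - i. *)
Lemma cut_path (T : Type) (x : T) (t : seq T) i j : i <= j -> j < size t ->
  x :: t = (x :: take i t) ++ drop i (take j t) ++ nth x t j :: drop j.+1 t /\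
  last x (take i t) = nth x (x :: t) i.
Proof.
move=> ij jt; split.
  by rewrite -drop_nth // catA cat_cons -(take_takel t ij) cat_take_drop cat_cons cat_take_drop.
case: i ij => [|i] ij; first by rewrite take0.
by rewrite (take_nth x) ?last_rcons //; lia.
Qed.

Section Ends.
Variables (T : finType) (e : rel T) (d p : nat).
Hypothesis G : extremal e d p.
Let e_sym := ex_sym G.
Let e_irr := ex_irr G.
Variables (x : T) (t : seq T).
Hypothesis Gs : gpath e (x :: t).
Hypothesis sz : (size t).+1 = p.

Let A j := e x (nth x t j).
Let B i := e (last x t) (nth x (x :: t) i).

Lemma last_nbr y : e (last x t) y -> y \in x :: t.
Proof.
move=> h; have : arms e x [::] t by rewrite -(gpath_pivot e_sym).
by move/(longest_arms G)=> /(_ y); rewrite -sz /=; apply.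
Qed.

Lemma ends_cycle i j : i <= j -> j < size t -> A j -> B i ->
  exists s, gcycle e s /\ size s = p - (j - i).
Proof.
move=> ij jt Aj Bi; have [E L] := cut_path x ij jt.
exists ((x :: take i t) ++ rev (nth x t j :: drop j.+1 t)); split.
  apply: (cross_cycle e_sym (mid := drop i (take j t))); rewrite -?E //.
  suff -> : last (nth x t j) (drop j.+1 t) = last x t by rewrite L.
  by rewrite -[RHS]/(last x (x :: t)) E !last_cat.
by rewrite size_cat size_rev /= size_drop size_take; case: ifP; lia.
Qed.

Lemma ends_disjoint i : i < size t -> A i -> B i -> False.
Proof.
move=> it Ai Bi; have [s [Cs ss]] := ends_cycle (leqnn i) it Ai Bi.
by have := gcycle_bound G Cs; rewrite ss; lia.
Qed.

Lemma count_nth (P : pred T) (s : seq T) : count P s = count (fun i => P (nth x s i)) (iota 0 (size s)).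
Proof. by rewrite -[in LHS](mkseq_nth x s) count_map. Qed.

Lemma deg_count z s : uniq s -> (forall y, e z y -> y \in s) -> d <= count (e z) s.
Proof.
move=> Us H; apply: leq_trans (ex_deg G z) _.
rewrite -size_filter -(card_uniqP (filter_uniq _ Us)).
by apply/subset_leq_card/subsetP => y; rewrite inE mem_filter => zy; rewrite zy H.
Qed.

(** All neighbours of both ends lie on the path, so A and B have at least d members each among the p
    - 1 indices; since they are disjoint, the rest bounds the indices in neither. *)
Lemma ends_neither : count (fun i => ~~ A i && ~~ B i) (iota 0 (size t)) + d.*2 <= size t.
Proof.
have U : uniq (x :: t) by case/andP: Gs.
have hA : d <= count A (iota 0 (size t)).
  rewrite -(count_nth (e x)); have /andP[_ Ut] := U.
  apply: deg_count => // y xy.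
  have := longest_head G Gs; rewrite -sz => /(_ y erefl xy); rewrite inE => /orP[/eqP yx|//].
  by rewrite yx e_irr in xy.
have hB : d <= count B (iota 0 (size t)).
  rewrite (@eq_in_count _ _ (fun i => e (last x t) (nth x (belast x t) i))); last first.
    move=> i; rewrite mem_iota /= => it.
    by rewrite /B lastI nth_rcons size_belast it.
  have := count_nth (e (last x t)) (belast x t); rewrite size_belast => <-.
  move: U; rewrite lastI rcons_uniq => /andP[_ Ub]; apply: deg_count => // y ly.
  have := last_nbr ly; rewrite lastI mem_rcons inE => /orP[/eqP yl|//].
  by rewrite yl e_irr in ly.
have := count_predUI A B (iota 0 (size t)).
rewrite (_ : count (predI A B) _ = 0); last first.
  apply/eqP; rewrite -leqn0 leqNgt -has_count; apply/hasPn => i; rewrite mem_iota /= => it.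
  by apply/negP => /andP[Ai Bi]; apply: (ends_disjoint it Ai Bi).
have := count_predC (predU A B) (iota 0 (size t)); rewrite size_iota.
rewrite (@eq_count _ (predC (predU A B)) (fun i => ~~ A i && ~~ B i)); first by lia.
by move=> i; rewrite /= negb_or.
Qed.

Lemma longest_size : d.*2 < p.
Proof. by have := ends_neither; lia. Qed.

Lemma ends_crossing i j : i <= j -> j < size t -> A j -> B i ->
  exists i' j', [/\ i' < j', j' < size t, A j', B i' & p - (j' - i') >= d.*2].
Proof.
move=> ij jt Aj Bi.
pose Q g := has (fun i => [&& i + g < size t, A (i + g) & B i]) (iota 0 (size t)).
have QE : exists g, Q g.
  exists (j - i); apply/hasP; exists i; first by rewrite mem_iota; lia.
  by rewrite subnKC // jt Aj Bi.
case: (ex_minnP QE) => g /hasP[i' _ /and3P[gt Ag Bg]] gmin.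
have g0 : 0 < g.
  case: (posnP g) gt Ag => // ->; rewrite addn0 => gt Ag.
  by case: (ends_disjoint gt Ag Bg).
exists i', (i' + g); split=> //; first by lia.
(* By minimality of g, an index of A strictly inside the gap would pair too closely with i', an
   index of B with i' + g. So the g - 1 inner indices are in neither set, and [ends_neither] bounds
   g. *)
have sub : {subset iota i'.+1 g.-1 <= [seq l <- iota 0 (size t) | ~~ A l && ~~ B l]}.
  move=> l; rewrite mem_iota mem_filter mem_iota => il; apply/andP; split; last by lia.
  apply/andP; split; apply/negP => h.
    suff /gmin : Q (l - i') by lia.
    apply/hasP; exists i'; first by rewrite mem_iota; lia.
    by rewrite subnKC; [rewrite h Bg andbT; lia | lia].
  suff /gmin : Q (i' + g - l) by lia.
  apply/hasP; exists l; first by rewrite mem_iota; lia.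
  by rewrite subnKC; [rewrite h Ag; lia | lia].
rewrite addKn; have := uniq_leq_size (iota_uniq _ _) sub; rewrite size_iota size_filter.
have := ends_neither; move: (count _ _) => N; move: sz gt; clear; lia.
Qed.
End Ends.

Section Dichotomy.
Variables (T : finType) (e : rel T) (d p : nat).
Hypothesis G : extremal e d p.
Let e_sym := ex_sym G.
Let e_irr := ex_irr G.

Lemma extremal_size : d.*2 < p.
Proof.
have [[|x t] [Gs sz]] := ex_path G; last exact: (longest_size G Gs sz).
have [z _] : exists z : T, true.
  by have := ex_card G; rewrite -sz => /card_gt0P[z _]; exists z.
by have := ex_max G (s := [:: z]) isT; rewrite -sz.
Qed.

Lemma noncrossing_or_cycle : noncrossing e p \/
  exists x a mid y b, [/\ gpath e ((x :: a) ++ mid ++ y :: b),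
    size ((x :: a) ++ mid ++ y :: b) = p, e x y, e (last y b) (last x a)
    & 0 < size mid <= p - d.*2].
Proof.
apply: NNPP => /not_or_and[nc H]; apply: nc => x a y b z Gs sz xy lz.
apply/negPn/negP => zyb; apply: H.
have sz' : (size (a ++ y :: b)).+1 = p by rewrite -sz.
have lz' : e (last x (a ++ y :: b)) z by rewrite last_cat.
have zs := last_nbr G Gs sz' lz'.
set t := a ++ y :: b in Gs sz' lz' zs.
have [||||i [j []]] := @ends_crossing _ _ _ _ G x t Gs sz' (index z (x :: t)) (size a).
- move: zs zyb; rewrite /t -cat_cons mem_cat orbC => /orP[->//|za _].
  by rewrite index_cat za; move: za; rewrite -index_mem /=; lia.
- by rewrite /t size_cat /= ; lia.
- by rewrite /t nth_cat ltnn subnn.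
- by rewrite nth_index.
move=> ij jt Aj Bi pj; have [E L] := cut_path x (ltnW ij) jt.
exists x, (take i t), (drop i (take j t)), (nth x t j), (drop j.+1 t).
rewrite -E; split=> //.
  suff -> : last (nth x t j) (drop j.+1 t) = last x t by rewrite L.
  by rewrite -[RHS]/(last x (x :: t)) E !last_cat.
by rewrite size_drop size_take jt; have := extremal_size; lia.
Qed.

Hypothesis nc : noncrossing e p.

(** The edge from the end of u to c serves as the edge x y of [noncrossing], with y = c. *)
Lemma noncrossing_arms c u w : arms e c u w -> size u + size w = p.-1 ->
  e (last c u) c -> forall y, e (last c w) y -> y \in c :: w.
Proof.
move=> A sz uc y ly; move: A; rewrite -(gpath_pivot e_sym).
have p0 := extremal_size.
case: (lastP u) sz uc => [|u' x] sz; first by rewrite /= e_irr.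
rewrite last_rcons rev_rcons => xc Gs.
by apply: (nc (x := x) (a := rev u')) => //; rewrite /= size_cat size_rev /=;
  move: sz; rewrite size_rcons; lia.
Qed.

Lemma noncrossing_split : exists c u w,
  [/\ arms e c u w, size u + size w = p.-1, e (last c w) c,
      forall y, e (last c u) y -> y \in c :: u & forall y, e (last c w) y -> y \in c :: w].
Proof.
have p0 := extremal_size; have d0 := ex_pos G.
have [[|x t] [Gs sz]] := ex_path G; first by move: sz => /=; lia.
pose l := last x t.
have [z lz] : exists z, e l z.
  by have := leq_trans d0 (ex_deg G l) => /card_gt0P[z]; rewrite inE; exists z.
have hs : has (e l) (x :: t) by apply/hasP; exists z => //; apply: (last_nbr G Gs sz).
have := hs; rewrite has_find.
have := nth_find x hs; have bf := @before_find _ x (e l) (x :: t).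
set i := find _ _ in bf * => lc il.
pose c := nth x (x :: t) i; pose s1 := take i (x :: t); pose w := drop i.+1 (x :: t).
have E : x :: t = s1 ++ c :: w by rewrite -drop_nth // cat_take_drop.
have El : l = last c w by rewrite /l -[LHS]/(last x (x :: t)) E last_cat.
have A : arms e c (rev s1) w by rewrite -(gpath_pivot e_sym) revK -E.
have Hw y : e l y -> y \in c :: w.
  move=> ly; have := last_nbr G Gs sz ly; rewrite E mem_cat => /orP[/(nthP x)[j js jy]|//].
  have ji : j < i by move: js; rewrite /s1 size_take; case: ifP; lia.
  by have := bf j ji; rewrite -jy /s1 nth_take // in ly *; rewrite ly.
exists c, (rev s1), w; split=> //.
- by rewrite size_rev; move: sz; rewrite E size_cat /=; lia.
- by rewrite -El.
(* If c were the first vertex, the path would close up to a cycle of order p. *)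
- case Es: s1 => [|x' a].
    have Ec : c = x by move: E; rewrite Es => -[].
    have lx : e (last x t) (nth x (x :: t) 0) by move: lc; rewrite -/c Ec.
    exfalso; apply: (ends_disjoint G Gs sz (i := 0)) lx; first by move: sz => /=; lia.
    case: (t) Gs sz => [|v t']; first by move=> _ /=; lia.
    by rewrite gpath_cons => /andP[/= /andP[xv _] _] _.
  have Ex : x' = x by move: E; rewrite Es => -[].
  rewrite Ex in Es *; rewrite rev_cons last_rcons => y xy.
  have := longest_head G Gs; rewrite -sz => /(_ y erefl xy).
  rewrite E Es mem_cat -rev_cons !inE mem_rev inE.
  case: (y == x) => //=; case ya : (y \in a); rewrite ?orbT //=.
  case: (y == c) => //= yw; exfalso.
  case/splitPr: yw E El Hw A => b1 b2 E El Hw A.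
  have E' : x :: t = x :: (a ++ c :: b1) ++ y :: b2 by rewrite E Es /= -catA.
  have := nc (x := x) (a := a ++ c :: b1) (y := y) (b := b2) (z := c).
  rewrite -E' => /(_ Gs sz xy); rewrite (_ : last y b2 = l) => [/(_ lc)|]; last by rewrite El last_cat.
  move: A; rewrite /arms => /and3P[_ _]; rewrite /= !mem_cat !inE => /andP[/negP H _].
  by move=> h; apply: H; rewrite ?mem_cat ?inE h !orbT.
- by move=> y; rewrite -El; apply: Hw.
Qed.
End Dichotomy.

(** * Pendant cliques *)

(** With c, the set W is one of the blocks K_(d+1) of G_1(n,k). The boolean form lets the predicate
    define sets of vertices. *)
Definition pendant (T : finType) (e : rel T) (d : nat) (c v : T) :=
  [exists W : {set T}, [&& v \in W, c \notin W, #|W| == d &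
    [forall x in W, [forall y, e x y == (y \in c |: W) && (y != x)]]]].

Lemma pendantP (T : finType) (e : rel T) (d : nat) (c v : T) :
  reflect (exists W : {set T}, [/\ v \in W, c \notin W, #|W| = d &
             {in W, forall x y, e x y = (y \in c |: W) && (y != x)}])
          (pendant e d c v).
Proof.
apply: (iffP existsP) => -[W].
  case/and4P => vW cW /eqP dW /forall_inP H; exists W; split=> // x xW y.
  by have /forallP/(_ y)/eqP := H x xW.
case=> vW cW dW H; exists W; rewrite vW cW dW eqxx /=.
by apply/forall_inP => x xW; apply/forallP => y; rewrite H.
Qed.

Section Pendant.
Variables (T : finType) (e : rel T) (d : nat).

Lemma pendant_center c v : pendant e d c v -> e v c.
Proof.
case/pendantP => W [vW cW _ H]; rewrite H // !inE eqxx /=.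
by apply: contraNneq cW => ->.
Qed.

Lemma pendant_neq c v : pendant e d c v -> v != c.
Proof. by case/pendantP => W [vW cW _ _]; apply: contraNneq cW => <-. Qed.

Lemma pendant_nbr c v y : pendant e d c v -> e v y -> y = c \/ pendant e d c y.
Proof.
case/pendantP => W [vW cW dW H]; rewrite H // !inE => /andP[/orP[/eqP|yW _]]; first by left.
by right; apply/pendantP; exists W.
Qed.

Lemma pendant_deg c v : pendant e d c v -> deg e v = d.
Proof.
case/pendantP => W [vW cW dW H]; rewrite /deg.
have -> : [set y | e v y] = (c |: W) :\ v.
  by apply/setP => y; rewrite inE H // !inE andbC.
have := cardsD1 v (c |: W); rewrite cardsU1 cW dW !inE vW orbT /=; lia.
Qed.
End Pendant.

Section Extremal.
Variables (T : finType) (e : rel T) (d p : nat).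
Hypothesis G : extremal e d p.
Let e_sym := ex_sym G.
Let e_irr := ex_irr G.

(* Reversing the part of w after a vertex adjacent to its last vertex shows that
   every vertex of w ends an arrangement of w. *)
Lemma clique_nbrs c w : path e c w -> uniq (c :: w) -> size w = d ->
  (forall w', perm_eq w' w -> path e c w' -> forall y, e (last c w') y -> y \in c :: w) ->
  {in w, forall v y, e v y = (y \in c :: w) && (y != v)}.
Proof.
move=> cw Uw sw H.
have full v w' : v \in w -> perm_eq w' w -> path e c w' -> last c w' = v ->
    forall y, e v y = (y \in c :: w) && (y != v).
  move=> vw pw cw' <- y; apply/idP/andP.
    by move=> ly; split; [exact: H pw cw' y ly | apply/negP => /eqP E; rewrite E e_irr in ly].
  case=> yw yl; apply: (nbrs_full G _ (H _ pw cw')) yw yl; last by rewrite /= sw.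
  by have := mem_last c w'; rewrite !inE (perm_mem pw).
suff ends v : v \in w -> exists w', [/\ perm_eq w' w, path e c w' & last c w' = v].
  by move=> v vw y; have [w' [pw cw' lw']] := ends v vw; exact: full lw' y.
move=> vw; have [w1 [w2 E]] : exists w1 w2, w = w1 ++ v :: w2.
  by case/splitPr: vw => w1 w2; exists w1, w2.
case: w2 => [|z w2] in E.
  by exists w; rewrite E last_cat -E.
exists (w1 ++ rev (v :: z :: w2)); split.
- by rewrite E perm_cat2l perm_rev.
- have -> : rev [:: v, z & w2] = last z w2 :: rev (belast v (z :: w2)).
    by rewrite [in LHS]lastI rev_rcons.
  have /andP[Pw1 /= /andP[cv vz]] : path e c w1 && path e (last c w1) (v :: z :: w2).
    by rewrite -cat_path -E.
  have ll : last z w2 \in z :: w2 by rewrite mem_last.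
  have lw : last z w2 \in w by rewrite E mem_cat inE ll !orbT.
  rewrite cat_path; have rp : path e (last v (z :: w2)) (rev (belast v (z :: w2))).
    by rewrite rev_path path_flip.
  rewrite Pw1 andTb; apply/andP; split; last exact: rp.
  rewrite e_sym (full _ w) //; last by rewrite E last_cat.
  have lc := mem_last c w1; have := Uw; rewrite E -cat_cons cat_uniq => /and3P[_ /hasPn h _].
  apply/andP; split; first by rewrite mem_cat lc.
  by apply: contraTneq lc => ->; apply: h; rewrite inE ll orbT.
- by rewrite last_cat rev_cons last_rcons.
Qed.

Lemma clique_pendant c w : path e c w -> uniq (c :: w) -> size w = d ->
  (forall w', perm_eq w' w -> path e c w' -> forall y, e (last c w') y -> y \in c :: w) ->
  {in w, forall v, pendant e d c v}.
Proof.
move=> cw Uw sw H v vw; have full := clique_nbrs cw Uw sw H.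
apply/pendantP; exists [set y in w]; split.
- by rewrite inE.
- by rewrite inE; case/andP: Uw.
- by rewrite cardsE; move: Uw => /andP[_ /card_uniqP]; rewrite sw.
- by move=> x; rewrite inE => xw y; rewrite full // !inE.
Qed.

(** A path from c into U with fewer than d further vertices can be prolonged, because its end has d
    neighbours, all in U or equal to c. With d further vertices it no longer can, whatever its
    arrangement, so [clique_pendant] applies. *)
Lemma pendant_exists c (U : {set T}) : c \notin U -> (exists2 v, v \in U & e c v) ->
  (forall w, path e c w -> uniq (c :: w) -> w <> [::] -> {subset w <= U} ->
    size w <= d /\ forall y, e (last c w) y -> y = c \/ y \in U) ->
  exists2 v, v \in U & pendant e d c v.
Proof.
move=> cU [v vU cv] H.
pose P w := [/\ path e c w, uniq (c :: w), w <> [::] & {subset w <= U}].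
have step w y : P w -> e (last c w) y -> y \notin c :: w -> P (rcons w y).
  move=> [cw Uw w0 wU] ly yw; split.
  - by rewrite rcons_path cw.
  - by rewrite -rcons_cons rcons_uniq yw.
  - by case: (w).
  - move=> u; rewrite mem_rcons inE => /orP[/eqP->|/wU//].
    have [_ /(_ y ly)[yc|//]] := H w cw Uw w0 wU.
    by move: yw; rewrite yc mem_head.
have long i : i < d -> exists w, P w /\ size w = i.+1.
  elim: i => [_|i IH id].
    exists [:: v]; split=> //; split=> //=; first by rewrite cv.
      by rewrite inE andbT; apply: contraNneq cU => ->.
    by move=> u; rewrite inE => /eqP->.
  have [w [Pw sw]] := IH (ltnW id).
  have [y ly yw] : exists2 y, e (last c w) y & y \notin c :: w.
    have [/existsP[y /andP[]]|/existsPn h] := boolP [exists y, e (last c w) y && (y \notin c :: w)].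
      by exists y.
    have := nbrs_size G (mem_last c w); rewrite /= sw.
    suff h' : forall y, e (last c w) y -> y \in c :: w by move/(_ h'); lia.
    by move=> y ly; have := h y; rewrite ly /= negbK.
  by exists (rcons w y); split; [exact: step | rewrite size_rcons sw].
have [w [Pw sw]] := long d.-1 (ltac:(have := ex_pos G; lia)).
have {}sw : size w = d by have := ex_pos G; lia.
have [cw Uw w0 wU] := Pw.
have pend := @clique_pendant c w cw Uw sw.
have [u uw] : exists u, u \in w by case: (w) w0 => // a l _; exists a; rewrite mem_head.
exists u; first exact: wU.
(* A neighbour outside [c :: w] would extend the rearranged path to d + 1 vertices in U. *)
apply: pend uw => w' pw cw' y ly; apply/negPn/negP => yw.
have Pw' : P w'.
  split=> //; first by rewrite (perm_uniq (_ : perm_eq _ (c :: w))) // perm_cons.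
    by move=> E; move: (perm_size pw); rewrite E sw; have := ex_pos G; case: (d).
  by move=> z; rewrite (perm_mem pw); apply: wU.
have yw' : y \notin c :: w' by move: yw; rewrite !inE (perm_mem pw).
have [h1 h2 h3 h4] := step w' y Pw' ly yw'.
by have [] := H _ h1 h2 h3 h4; rewrite size_rcons (perm_size pw) sw ltnn.
Qed.

End Extremal.

(** * Parametrised isomorphisms *)

Lemma set_param (T : finType) (A : {set T}) n : #|A| = n ->
  exists f : 'I_n -> T, injective f /\ (forall x, x \in A <-> exists i, f i = x).
Proof.
move=> <-; exists enum_val; split; first exact: enum_val_inj.
move=> x; split=> [xA|[i <-]]; last exact: enum_valP.
by exists (enum_rank_in xA x); rewrite enum_rankK_in.
Qed.

(** The models are built from sum types, so maps out of them are given by cases; the inverse is the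
    map that [isomorphic] asks for. *)
Lemma isomorphic_of_param (T M : finType) (e : rel T) (e2 : rel M) (g : M -> T) :
  injective g -> (forall x, exists i, g i = x) -> (forall i j, e (g i) (g j) = e2 i j) ->
  isomorphic e e2 /\ #|T| = #|M|.
Proof.
move=> gi gs ge.
have [f gK fK] : bijective g.
  apply: inj_card_bij => //; rewrite -(card_codom gi); apply/subset_leq_card/subsetP => x _.
  by have [i <-] := gs x; apply: codom_f.
split; last by rewrite (bij_eq_card (Bijective fK gK)).
by exists f; split; [exists g | move=> x y; rewrite -ge !fK].
Qed.

Lemma subgraph_of_param (T M : finType) (e : rel T) (e2 : rel M) (g : M -> T) :
  (forall x, exists i, g i = x) -> (forall i j, e (g i) (g j) -> e2 i j) ->
  subgraph_of e e2.
Proof.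
move=> gs ge.
have gs' x : exists i, g i == x by have [i <-] := gs x; exists i.
pose f x := xchoose (gs' x).
have fK x : g (f x) = x by apply/eqP; exact: xchooseP (gs' x).
by exists f; split=> [x y E|x y xy]; [rewrite -(fK x) E fK | apply: ge; rewrite !fK].
Qed.

(** Within D, each W is the closed neighbourhood of each of its vertices, so these sets partition D
    and t is their number. The casts identify ['I_d] with the index type of each class. *)
Lemma clique_classes (T : finType) (e : rel T) (D : {set T}) d :
  {in D, forall x, exists W : {set T}, [/\ x \in W, W \subset D, #|W| = d &
     {in W & D, forall x' y, e x' y = (y \in W) && (y != x')}]} ->
  exists t (f : 'I_t * 'I_d -> T), [/\ injective f, forall x, x \in D <-> exists i, f i = x
    & forall i j, e (f i) (f j) = copiesg t (completeg d) i j].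
Proof.
move=> H; pose cls x := [set y in D | (y == x) || e x y].
have clsW x : x \in D -> exists2 W : {set T}, [/\ x \in W, W \subset D, #|W| = d &
     {in W & D, forall x' y, e x' y = (y \in W) && (y != x')}] & {in W, forall z, cls z = W}.
  move=> xD; have [W [xW WD dW HW]] := H x xD; exists W => // z zW.
  apply/setP => y; rewrite !inE; have [yD|yD] /= := boolP (y \in D).
    by rewrite HW //; have [->|_] /= := eqVneq y z; rewrite ?zW ?andbT.
  by apply/esym/negbTE; apply: contra yD; apply: (subsetP WD).
pose P := [set cls x | x in D].
have PW A : A \in P -> [/\ #|A| = d, A \subset D & {in A, forall z, cls z = A}].
  case/imsetP=> x xD ->; have [W [xW WD dW HW] cW] := clsW x xD.
  by rewrite cW.
have dP (i : 'I_#|P|) : d = #|enum_val i| by have [] := PW _ (enum_valP i).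
exists #|P|, (fun q => enum_val (cast_ord (dP q.1) q.2)).
have fin q : enum_val (cast_ord (dP q.1) q.2) \in enum_val q.1 by exact: enum_valP.
have clsf q : cls (enum_val (cast_ord (dP q.1) q.2)) = enum_val q.1.
  by have [_ _ ->] := PW _ (enum_valP q.1).
split.
- move=> [i j] [i' j'] E; have := clsf (i, j); rewrite E clsf /= => /enum_val_inj Ei.
  by move: E; rewrite -Ei /= => /enum_val_inj/cast_ord_inj ->.
- move=> x; split=> [xD|[q <-]]; last first.
    by have [_ /subsetP AD _] := PW _ (enum_valP q.1); apply: AD (fin q).
  have cP : cls x \in P by apply: imset_f.
  have xx : x \in enum_val (enum_rank_in cP (cls x)).
    by rewrite enum_rankK_in // !inE xD eqxx.
  pose i := enum_rank_in cP (cls x); pose j := enum_rank_in xx x.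
  by exists (i, cast_ord (esym (dP i)) j); rewrite /= cast_ordKV enum_rankK_in.
- move=> [i j] [i' j']; rewrite /copiesg /completeg /=.
  set x := enum_val _; set y := enum_val _.
  have xi : x \in enum_val i := fin (i, j).
  have yi : y \in enum_val i' := fin (i', j').
  have [_ /subsetP AD AC] := PW _ (enum_valP i).
  have [_ /subsetP AD' AC'] := PW _ (enum_valP i').
  have xD := AD x xi; have yD := AD' y yi.
  have [W [xW _ _ HW] cW] := clsW x xD.
  rewrite HW // -(cW x xW) (AC x xi).
  have [ii|ii] := eqVneq i i'.
    move: @y yi yD; rewrite -ii => y yi _; rewrite yi /=.
    by rewrite /x /y (inj_eq enum_val_inj) (inj_eq (@cast_ord_inj _ _ _)) eq_sym.
  apply/negbTE; rewrite negb_and; apply/orP; left; apply: contra ii => yA.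
  by apply/eqP; apply: enum_val_inj; rewrite -(AC y yA) (AC' y yi).
Qed.

(** * A longest cycle of order p - 1 *)

Section LongCycle.
Variables (T : finType) (e : rel T) (d p : nat).
Hypothesis G : extremal e d p.
Let e_sym := ex_sym G.
Let e_irr := ex_irr G.

Section Cycle.
Variable C : seq T.
Hypothesis GC : gcycle e C.
Hypothesis sC : (size C).+1 = p.
Hypothesis dC : d.*2 <= size C <= d.*2.+1.

(** S adds to C the outer vertices whose neighbours are all on C. An edge leaving S starts on C and
    ends at some b with a neighbour b' off C; then C opened there, prolonged by b and b', has p + 1
    vertices. *)
Lemma off_cycle_nbr x y : x \notin C -> e x y -> y \in C.
Proof.
move=> xC xy; apply/negPn/negP => yC.
pose S := [set z | (z \in C) || [forall w, e z w ==> (w \in C)]].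
have [c cC] : exists c, c \in C.
  by have := ex_pos G; case: (C) dC => [|a l]; [rewrite /=; lia | exists a; rewrite mem_head].
have [||a [b []]] := @edge_out _ _ _ _ G S c x.
- by rewrite inE cC.
- by rewrite inE (negPf xC) /=; apply/forallPn; exists y; rewrite xy.
rewrite !inE negb_or => aS /andP[bC /forallPn[b']]; rewrite negb_imply => /andP[bb' b'C] ab.
have aC : a \in C.
  by case/orP: aS => // /forallP/(_ b); rewrite ab (negPf bC).
have [r [ar Pr _]] := gcycle_rot GC aC.
have : arms e a [:: b; b'] r.
  rewrite /arms /= ab bb' ar /=; have := perm_uniq Pr; have := perm_mem Pr.
  case/andP: GC => -> _ h /= /andP[h1 ->]; rewrite !inE (negPf h1).
  have := h b; have := h b'; rewrite !inE (negPf bC) (negPf b'C) eq_sym.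
  move=> /negbT/norP[n1 m1] /negbT/norP[n2 m2].
  rewrite (negPf n1) (eq_sym a b) (negPf n2) (negPf m1) (negPf m2) /= orbF andbT.
  by apply: contraTneq bb' => ->; rewrite e_irr.
by move/(arms_bound G); rewrite -sC -(perm_size Pr) /= add2n ltnn.
Qed.

(** If x = y, inserting it after c gives a cycle of order p; otherwise C opened after c, with x and
    y put at the two ends, is a path of order p + 1. *)
Lemma off_cycle_next x y c : x \notin C -> y \notin C -> e x c -> e y (next C c) -> False.
Proof.
move=> xC yC xc yc.
have cC : c \in C := off_cycle_nbr xC xc.
have [r [ar Pr lr]] := gcycle_span e_sym GC cC.
have Uc : uniq (c :: r) by rewrite (perm_uniq Pr); case/andP: GC.
have [xy|xy] := eqVneq x y.
  subst y; have : gcycle e (x :: c :: r).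
    rewrite /gcycle cons_uniq Uc (perm_mem Pr) xC /= xc rcons_path ar /= lr.
    by rewrite e_sym yc.
  by move/(gcycle_bound G)=> /(_ isT); move: (perm_size Pr) => /= ->; rewrite -sC ltnn.
have : gpath e (x :: c :: rcons r y).
  rewrite gpath_cons /= xc rcons_path ar lr e_sym yc /= -rcons_cons.
  move: xC yC; rewrite -!(perm_mem Pr) => xC yC.
  by rewrite mem_rcons in_cons (negPf xy) (negPf xC) -[_ && uniq _]/(uniq (rcons (c :: r) y)) rcons_uniq yC.
by move/(ex_max G); rewrite /= size_rcons -sC -(perm_size Pr) /= ltnn.
Qed.

Let N x := [set y | e x y].

Lemma card_N x : d <= #|N x|.
Proof. exact: (ex_deg G). Qed.

(** Y and the set of its successors are disjoint subsets of C, whose order is at most 2d + 1. *)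
Lemma indep_cycle (Y : {set T}) : {in Y, forall c, c \in C /\ next C c \notin Y} -> #|Y| <= d.
Proof.
move=> H; have [UC _] := andP GC.
have ni : injective (next C) by apply: can_inj (prev_next UC).
have : #|Y :|: [set next C c | c in Y]| <= size C.
  rewrite -(card_uniqP UC); apply/subset_leq_card/subsetP => c; rewrite inE => /orP[/H[]//|].
  by case/imsetP=> c' /H[c'C _] ->; rewrite mem_next.
rewrite cardsU (_ : _ :&: _ = set0) ?cards0 ?subn0 ?card_imset //; first by lia.
apply/setP => c; rewrite !inE; apply/negP => /andP[cY /imsetP[c' c'Y E]].
by have [_] := H c' c'Y; rewrite -E cY.
Qed.

(** The union of the two neighbourhoods contains no two consecutive vertices of C, so it has at most
    d elements, while each of the two has at least d. *)
Lemma off_cycle_eq x y : x \notin C -> y \notin C -> N x = N y /\ #|N x| = d.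
Proof.
move=> xC yC; have UU : #|N x :|: N y| <= d.
  apply: indep_cycle => c; rewrite !inE => /orP[] h; split.
  - exact: off_cycle_nbr xC h.
  - by apply/negP => /orP[] h'; [exact: (off_cycle_next xC xC h h')|exact: (off_cycle_next xC yC h h')].
  - exact: off_cycle_nbr yC h.
  - by apply/negP => /orP[] h'; [exact: (off_cycle_next yC xC h h')|exact: (off_cycle_next yC yC h h')].
have hx := card_N x; have hy := card_N y.
have sx : N x = N x :|: N y by apply/eqP; rewrite eqEcard subsetUl /=; lia.
have sy : N y = N x :|: N y by apply/eqP; rewrite eqEcard subsetUr /=; lia.
split; first by rewrite sx -sy.
by apply/eqP; rewrite eqn_leq hx andbT sx.
Qed.

End Cycle.

(** X is the common neighbourhood of the outer vertices, B the part of C outside X lacking a vertex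
    of X on at least one side. Of the [size C - d] cycle vertices outside X, d follow and d precede
    a vertex of X, which bounds B. *)
Lemma long_cycle_join C : gcycle e C -> (size C).+1 = p -> d.*2 <= size C <= d.*2.+1 ->
  exists X B : {set T}, [/\ #|X| = d, #|B| <= (size C - d.*2).*2, [disjoint X & B]
    & forall v, v \notin X -> v \notin B -> forall y, e v y = (y \in X)].
Proof.
move=> GC sC dC; have [UC _] := andP GC; have d0 := ex_pos G.
(* Since [size C + 1 = p < #|T|], two outer vertices exist: x will be exchanged into the cycle while
   y stays outside for comparison. *)
have [x [y [xC yC xy]]] : exists x y, [/\ x \notin C, y \notin C & x != y].
  have : 1 < #|~: [set z in C]|.
    have := cardsC [set z in C]; rewrite cardsE (card_uniqP UC); have := ex_card G; lia.
  case/card_gt1P=> x [y [xC yC xy]]; exists x, y; split=> //; first by rewrite !inE in xC.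
  by rewrite !inE in yC.
pose X := [set z | e x z].
have [_ cX] := off_cycle_eq GC sC dC xC xC.
have NX z : z \notin C -> forall w, e z w = (w \in X).
  move=> zC w; have [E _] := off_cycle_eq GC sC dC xC zC.
  by move/setP/(_ w): E; rewrite !inE.
have XC z : z \in X -> z \in C by rewrite inE => /(off_cycle_nbr GC sC dC xC).
(* As r lies between two vertices of X, x can replace it on the cycle. Then r and y are both off a
   cycle of the same order, so r has the neighbourhood of y. *)
have swap r : r \in C -> prev C r \in X -> next C r \in X -> forall w, e r w = (w \in X).
  move=> rC; set c := prev C r => cX' nX w.
  have nc : next C c = r by rewrite next_prev.
  have [|r' [cr' Pr lr']] := gcycle_span2 e_sym GC (XC c cX'); first by move: dC d0; clear; lia.
  rewrite nc in Pr lr'.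
  have Ur : uniq (r :: c :: r') by rewrite (perm_uniq Pr).
  have xr : x \notin r :: c :: r' by rewrite (perm_mem Pr).
  have GC' : gcycle e (x :: c :: r').
    rewrite /gcycle cons_uniq; move: Ur xr; rewrite cons_uniq => /andP[_ ->].
    rewrite inE negb_or => /andP[_ ->] /=; rewrite rcons_path cr' lr' /=.
    by move: cX' nX; rewrite !inE => -> /=; rewrite e_sym.
  have sC' : size (x :: c :: r') = size C by rewrite -(perm_size Pr).
  have rC' : r \notin x :: c :: r'.
    by move: Ur => /andP[h _]; rewrite inE (negPf h) orbF; apply: contraNneq xC => <-.
  have yC' : y \notin x :: c :: r'.
    move: yC; rewrite -(perm_mem Pr) inE => /norP[_ h].
    by rewrite inE (negPf h) orbF eq_sym.
  have [||E _] := off_cycle_eq GC' _ _ rC' yC'; rewrite ?sC' //.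
  by move/setP/(_ w): E; rewrite !inE (NX y yC) inE.
pose S := [set z in C] :\: X.
have XS : X \subset [set z in C] by apply/subsetP => z /XC; rewrite inE.
have cS : #|S| = size C - d by rewrite (cardsDS XS) cX cardsE (card_uniqP UC).
have indep c : c \in X -> next C c \notin X.
  by rewrite !inE => xc; apply/negP => /(off_cycle_next GC sC dC xC xC xc).
pose S1 := [set next C c | c in X]; pose S2 := [set prev C c | c in X].
have sub1 : S1 \subset S.
  apply/subsetP => z /imsetP[c cXx ->]; rewrite !inE mem_next XC // andbT.
  by have := indep c cXx; rewrite inE.
have sub2 : S2 \subset S.
  apply/subsetP => z /imsetP[c cXx ->]; rewrite !inE mem_prev XC // andbT.
  by apply: contraTN cXx => h; have := indep (prev C c); rewrite next_prev // inE => /(_ h).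
have c1 : #|S1| = d by rewrite card_imset ?cX //; apply: can_inj (prev_next UC).
have c2 : #|S2| = d by rewrite card_imset ?cX //; apply: can_inj (next_prev UC).
exists X, ((S :\: S1) :|: (S :\: S2)); split=> //.
- have [] := leq_card_setU (S :\: S1) (S :\: S2); rewrite (cardsDS sub1) (cardsDS sub2) c1 c2 cS => + _; move: dC #|_|; clear; lia.
- rewrite disjoint_sym disjoints_subset; apply/subsetP => z; rewrite !inE.
  by case/orP => /and3P[].
- move=> v vX vB; have [vC|/NX//] := boolP (v \in C).
  have vS : v \in S by rewrite !inE vC andbT; move: vX; rewrite inE.
  move: vB; rewrite in_setU (in_setD S S1) (in_setD S S2) vS !andbT negb_or !negbK => /andP[].
  case/imsetP=> c cXx vc /imsetP[c' cX' vc'].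
  by apply: swap => //; [rewrite vc prev_next | rewrite vc' next_prev].
Qed.

End LongCycle.

Lemma set_between (T : finType) (A D : {set T}) k : A \subset D -> #|A| <= k <= #|D| ->
  exists B : {set T}, [/\ A \subset B, B \subset D & #|B| = k].
Proof.
move=> AD; elim: k => [|k IH] /andP[Ak kD].
  by exists A; split=> //; lia.
have [Ek|Nk] := eqVneq #|A| k.+1; first by exists A.
have [|B [AB BD cB]] := IH; first by move: Nk; lia.
have [x xDB] : exists x, x \in D :\: B.
  by apply/card_gt0P; rewrite (cardsDS BD); lia.
move: xDB; rewrite inE => /andP[xB xD]; exists (x |: B); split.
- exact: subset_trans AB (subsetUr _ _).
- by rewrite subUset sub1set xD.
- by rewrite cardsU1 xB cB.
Qed.

Lemma clique_lt (T : finType) (e : rel T) m (S : {set T}) : ~ has_Km e m ->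
  {in S &, forall x y, x != y -> e x y} -> #|S| < m.
Proof.
move=> nK cl; rewrite ltnNge; apply/negP => mS; apply: nK.
have [||B [_ BS cB]] := @set_between T set0 S m; rewrite ?sub0set ?cards0 ?mS //.
by exists B; split=> // x y /(subsetP BS) xS /(subsetP BS) yS; apply: cl.
Qed.

(** H is induced on X, and v0 extends any K_(m-1) in it to a K_m. *)
Lemma join_subgraph (T : finType) (e : rel T) d m (X B : {set T}) v0 :
  simple_graph e -> ~ has_Km e m -> #|X| = d -> [disjoint X & B] ->
  (forall v, v \notin X -> v \notin B -> forall y, e v y = (y \in X)) ->
  v0 \notin X -> v0 \notin B ->
  exists H : rel 'I_d, [/\ simple_graph H, ~ has_Km H m.-1,
    B = set0 -> subgraph_of e (joing H (emptyg (#|T| - d))) &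
    #|B| <= 2 -> d + 2 <= #|T| ->
      subgraph_of e (joing H (uniong (emptyg (#|T| - d - 2)) (completeg 2)))].
Proof.
move=> [e_sym e_irr] nK cX XB NX v0X v0B.
have [f [fi fX]] := set_param cX.
have fX' i : f i \in X by apply/fX; exists i.
exists (fun i j => e (f i) (f j)); split.
- by split=> [i j|i]; [exact: e_sym | exact: e_irr].
- move=> [S [cS clS]].
  have v0S : v0 \notin f @: S by apply: contra v0X => /imsetP[i _ ->].
  suff : #|v0 |: f @: S| < m by rewrite cardsU1 v0S card_imset // cS; lia.
  apply: clique_lt nK _ => x y; rewrite !inE.
  move=> /orP[/eqP->|/imsetP[i iS ->]] /orP[/eqP->|/imsetP[j jS ->]] xy.
  + by rewrite eqxx in xy.
  + by rewrite NX.
  + by rewrite e_sym NX.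
  + by apply: clS => //; apply: contraNneq xy => ->.
- move=> B0; have cC : #|~: X| = #|T| - d by have := cardsC X; lia.
  have [g [gi gX]] := set_param cC.
  apply: (@subgraph_of_param _ _ _ _ (fun s => match s with inl i => f i | inr j => g j end)).
    move=> x; have [/fX[i <-]|xX] := boolP (x \in X); first by exists (inl i).
    by have /gX[j <-] : x \in ~: X; [rewrite inE | exists (inr j)].
  move=> [i|j] [i'|j'] //=.
  have /[!inE] gj : g j \in ~: X by apply/gX; exists j.
  have /[!inE] gj' : g j' \in ~: X by apply/gX; exists j'.
  by rewrite NX ?(negPf gj') // B0 inE.
move=> B2 dT.
(* B is padded to exactly two vertices, since the model has a K_2 there. *)
have [||B' [BB' B'X cB']] := @set_between T B (~: X) 2.
- by rewrite -disjoints_subset disjoint_sym.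
- by have := cardsC X; lia.
have XB' : X :&: B' = set0 by apply/eqP; rewrite setI_eq0 disjoint_sym disjoints_subset.
have cC : #|~: (X :|: B')| = #|T| - d - 2.
  by have := cardsC (X :|: B'); rewrite cardsU XB' cards0; lia.
have [g [gi gX]] := set_param cC; have [h [hi hX]] := set_param cB'.
apply: (@subgraph_of_param _ _ _ _ (fun s => match s with inl i => f i | inr (inl j) => g j | inr (inr j) => h j end)).
  move=> x; have [/fX[i <-]|xX] := boolP (x \in X); first by exists (inl i).
  have [/hX[i <-]|xB] := boolP (x \in B'); first by exists (inr (inr i)).
  by have /gX[j <-] : x \in ~: (X :|: B'); [rewrite !inE (negPf xX) | exists (inr (inl j))].
have gXB j : (g j \notin X) && (g j \notin B').
  by have : g j \in ~: (X :|: B') by [apply/gX; exists j]; rewrite !inE negb_or.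
have gN j y : e (g j) y = (y \in X).
  by have /andP[gj1 gj2] := gXB j; rewrite NX //; apply: contra gj2; apply: (subsetP BB').
have hXn j : h j \notin X.
  have hB : h j \in B' by apply/hX; exists j.
  by have := subsetP B'X _ hB; rewrite inE.
move=> [i|[j|j]] [i'|[j'|j']] //=.
- by rewrite gN; have /andP[/negPf->] := gXB j'.
- by rewrite gN (negPf (hXn _)).
- by rewrite e_sym gN (negPf (hXn _)).
- by rewrite /completeg => hh; apply: contraTneq hh => ->; rewrite e_irr.
Qed.

(** * Pendant cliques as disjoint copies of K_d *)

Section PendantClasses.
Variables (T : finType) (e : rel T) (d : nat).

Lemma pendant_param c : exists t (f : 'I_t * 'I_d -> T),
  [/\ injective f, forall v, pendant e d c v <-> exists i, f i = v
    & forall i j, e (f i) (f j) = copiesg t (completeg d) i j].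
Proof.
have [|t [f [fi fD fe]]] := @clique_classes T e [set v | pendant e d c v] d.
  move=> x; rewrite inE => /pendantP[W [xW cW dW HW]]; exists W; split=> //.
    by apply/subsetP => y yW; rewrite inE; apply/pendantP; exists W.
  move=> x' y x'W; rewrite inE => /pendant_neq yc.
  by rewrite HW // !inE (negPf yc).
by exists t, f; split=> // v; rewrite -fD inE.
Qed.

Lemma pendant_param_pos c v t (f : 'I_t * 'I_d -> T) :
  (forall v, pendant e d c v <-> exists i, f i = v) -> pendant e d c v -> 0 < t.
Proof. by move=> H /H[[i _] _]; apply: leq_ltn_trans (ltn_ord i). Qed.

Lemma pendant_Km c v m : symmetric e -> ~ has_Km e m -> pendant e d c v -> d + 2 <= m.
Proof.
move=> e_sym nK /pendantP[W [vW cW dW H]].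
have : #|c |: W| < m; last by rewrite cardsU1 cW dW; lia.
apply: clique_lt nK _ => x y; rewrite !inE => /orP[/eqP->|xW] yW xy.
  by rewrite e_sym H ?xy ?inE ?eqxx //; case/orP: yW xy => // /eqP->; rewrite eqxx.
by rewrite H // !inE yW eq_sym.
Qed.

End PendantClasses.

(** * Covering the graph by pendant cliques when nothing crosses *)

Section Cover.
Variables (T : finType) (e : rel T) (d p : nat).
Hypothesis G : extremal e d p.
Let e_sym := ex_sym G.
Let e_irr := ex_irr G.

(** K is a part already understood. The set U of leftover vertices has no outside neighbour but c,
    so connectedness makes c adjacent to it, and [pendant_exists] produces a pendant vertex inside
    U, a contradiction. *)
Lemma pendant_cover c (K : {set T}) :
  (forall x y, x \in K -> y \notin K -> e x y -> y = c \/ pendant e d c y) ->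
  (forall w, path e c w -> uniq (c :: w) ->
     {in w, forall v, v \notin K /\ ~~ pendant e d c v} -> size w <= d) ->
  forall v, [|| v == c, v \in K | pendant e d c v].
Proof.
move=> HK Hw v; apply/negPn/negP => vN.
pose U := [set v | ~~ [|| v == c, v \in K | pendant e d c v]].
have cU : c \notin U by rewrite inE eqxx.
have UN x y : x \in U -> e x y -> y = c \/ y \in U.
  rewrite inE => /norP[xc /norP[xK xp]] xy; have [->|yc] := eqVneq y c; first by left.
  right; rewrite inE (negPf yc) /=; apply/norP; split; apply/negP => h.
    by case: (HK y x h xK); rewrite 1?e_sym // => E; rewrite E ?eqxx // in xc xp.
  by case: (pendant_nbr h (_ : e y x)); rewrite 1?e_sym // => E; rewrite E ?eqxx // in xc xp.
have [|a [b [aU bU ab]]] := edge_out G (x := v) (z := c) _ cU; first by rewrite inE.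
have bc : b = c by case: (UN a b aU ab) => // h; rewrite h in bU.
have [||u uU up] := pendant_exists G cU.
- by exists a; rewrite // e_sym -bc.
- move=> w cw Uw w0 wU; split.
    apply: Hw cw Uw _ => x /wU; rewrite inE => /norP[_ /norP[]] //.
  move=> y; apply: UN; apply: wU.
  by case: (w) w0 => // a' l _; exact: (mem_last a' l).
by move: uU; rewrite inE up !orbT.
Qed.

Hypothesis nc : noncrossing e p.

(** Rearranging w leaves the path longest and the arm u closed at c, so every possible end of w is
    confined; this is the hypothesis of [clique_nbrs]. *)
Lemma noncrossing_end c u w w' y : arms e c u w -> size u + size w = p.-1 ->
  e (last c u) c -> perm_eq w' w -> path e c w' -> e (last c w') y -> y \in c :: w.
Proof.
move=> A sz uc pw cw' ly; have /and3P[cu cw U] := A.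
have A' : arms e c u w'.
  rewrite /arms cu cw' /=; have := perm_uniq (_ : perm_eq (c :: u ++ w') (c :: u ++ w)).
  by move=> /= ->; rewrite // perm_cons perm_cat2l.
have := noncrossing_arms G nc A' _ uc ly; rewrite (perm_size pw) => /(_ sz).
by rewrite !inE (perm_mem pw).
Qed.

Lemma noncrossing_clique c u w : arms e c u w -> size u + size w = p.-1 -> size w = d ->
  e (last c u) c -> {in w, forall v, pendant e d c v}.
Proof.
move=> A sz sw uc; have /armsP[_ cw _ Uw _] := A.
by apply: (clique_pendant G cw Uw sw) => w' pw cw' y; exact: (noncrossing_end A sz uc pw cw').
Qed.

Lemma noncrossing_clique_nbrs c u w : arms e c u w -> size u + size w = p.-1 -> size w = d ->
  e (last c u) c -> {in w, forall v y, e v y = (y \in c :: w) && (y != v)}.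
Proof.
move=> A sz sw uc; have /armsP[_ cw _ Uw _] := A.
by apply: (clique_nbrs G cw Uw sw) => w' pw cw' y; exact: (noncrossing_end A sz uc pw cw').
Qed.

Lemma short_extremal_G1 : p = d.*2.+1 ->
  exists c, (exists v, pendant e d c v) /\ forall v, v != c -> pendant e d c v.
Proof.
move=> pE; have d0 := ex_pos G.
have [c [u [w [A sz lc Nu Nw]]]] := noncrossing_split G nc.
have su := nbrs_size G (mem_last c u) Nu; have sw := nbrs_size G (mem_last c w) Nw.
(* Each end has d neighbours on its own side, so each arm has at least d vertices, and together they
   have 2d. *)
have [{}su {}sw] : size u = d /\ size w = d by move: su sw sz; rewrite /= pE; lia.
have uc : e (last c u) c.
  apply: (nbrs_full G (mem_last c u) Nu); rewrite ?mem_head //=; first by rewrite su.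
  have /armsP[_ _ /andP[h _] _ _] := A; apply: contraNneq h => {1}->.
  by case: (u) su => [|a l _]; [move=> /=; lia | exact: (mem_last a l)].
have pw := noncrossing_clique A sz sw uc.
exists c; split.
  case: (w) sw pw => [|a l _ h]; first by move=> /=; lia.
  by exists a; apply: h; rewrite mem_head.
move=> v vc; suff : [|| v == c, v \in set0 | pendant e d c v] by rewrite (negPf vc) inE.
apply: pendant_cover => [x y|w' cw' Uw' Hw']; first by rewrite inE.
(* A path through uncovered vertices avoids w, whose vertices are pendant, so it can serve as the
   second arm. *)
have : arms e c w w'.
  have /armsP[_ Pw _ Uw _] := A; apply/armsP; split=> // x xw.
  by apply: contraL (pw x xw) => /Hw'[].
by move/(arms_bound G); rewrite sw pE; lia.
Qed.
End Cover.

(** * Two adjacent centres *)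

(** The arm u closes up to a cycle of order d + 2 through c, and w is the tail; the 2d + 2 vertices
    form a longest path when [p = d.*2.+2]. *)
Definition lollipop (T : finType) (e : rel T) (d : nat) (c : T) (u w : seq T) :=
  [/\ arms e c u w, size u = d.+1, size w = d & e (last c u) c].

Definition uncovered (T : finType) (e : rel T) (d : nat) (c1 c2 : T) :=
  [set v | ~~ [|| v == c1, v == c2, pendant e d c1 v | pendant e d c2 v]].

Section OneCentre.
Variables (T : finType) (e : rel T) (k : nat).
Let d := delta k.
Hypothesis e_sym : symmetric e.
Hypothesis e_irr : irreflexive e.

Lemma pendant_G1 c : (exists v, pendant e d c v) -> (forall v, v != c -> pendant e d c v) ->
  isG1 e #|T| k.
Proof.
move=> [v pv] H; have [t [f [fi fP fe]]] := pendant_param e d c.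
have fc i : pendant e d c (f i) by apply/fP; exists i.
have [|||I cT] := @isomorphic_of_param T (G1T t d) e (G1g t d)
    (fun s => match s with inl _ => c | inr i => f i end).
- move=> [i|i] [j|j] //=.
  + by rewrite !ord1.
  + by move=> E; have := pendant_neq (fc j); rewrite -E eqxx.
  + by move=> E; have := pendant_neq (fc i); rewrite E eqxx.
  + by move/fi=> ->.
- move=> x; have [->|/H/fP[i <-]] := eqVneq x c; first by exists (inl ord0).
  by exists (inr i).
- move=> [i|i] [j|j] //=.
  + by rewrite e_irr /completeg !ord1 eqxx.
  + by rewrite e_sym (pendant_center (fc j)).
  + by rewrite (pendant_center (fc i)).
exists t; split=> //; first exact: pendant_param_pos fP pv.
by rewrite cT card_sum card_prod !card_ord.
Qed.

Lemma pendant_G2 c1 c2 : e c1 c2 -> ~~ pendant e d c1 c2 -> ~~ pendant e d c2 c1 ->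
  (exists v, pendant e d c1 v) -> (exists v, pendant e d c2 v) ->
  uncovered e d c1 c2 = set0 -> isG2 e #|T| k.
Proof.
move=> cc n12 n21 [v1 pv1] [v2 pv2] U0.
have c12 : c1 != c2 by apply: contraTneq cc => ->; rewrite e_irr.
have [t1 [f1 [f1i f1P f1e]]] := pendant_param e d c1.
have [t2 [f2 [f2i f2P f2e]]] := pendant_param e d c2.
have f1c i : pendant e d c1 (f1 i) by apply/f1P; exists i.
have f2c i : pendant e d c2 (f2 i) by apply/f2P; exists i.
have fc1 i : (f1 i == c1) = false by apply/negbTE/(pendant_neq (f1c i)).
have fc2 i : (f2 i == c2) = false by apply/negbTE/(pendant_neq (f2c i)).
have fc12 i : (f1 i == c2) = false by apply: contraNF n12 => /eqP <-.
have fc21 i : (f2 i == c1) = false by apply: contraNF n21 => /eqP <-.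
have ef1 i : e (f1 i) c2 = false.
  by apply: contraNF n12 => /(pendant_nbr (f1c i))[E|//]; rewrite E eqxx in c12.
have ef2 i : e (f2 i) c1 = false.
  by apply: contraNF n21 => /(pendant_nbr (f2c i))[E|//]; rewrite E eqxx in c12.
have dis i v : pendant e d c2 v -> f1 i = v -> False.
  move=> pv E; have := pendant_center (f1c i); rewrite E => /(pendant_nbr pv)[Ec|p2].
    by rewrite Ec eqxx in c12.
  by rewrite p2 in n21.
have ef i j : e (f1 i) (f2 j) = false.
  apply/negP => /(pendant_nbr (f1c i))[E|/f1P[i' Ei']]; first by have := fc21 j; rewrite E eqxx.
  exact: dis (f2c j) Ei'.
have [|||I cT] := @isomorphic_of_param T (G1T t1 d + G1T t2 d)%type e (G2g t1 t2 d)
    (fun s => match s with inl (inl _) => c1 | inl (inr i) => f1 i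
                         | inr (inl _) => c2 | inr (inr i) => f2 i end).
- have nf (x y : T) (P : Prop) : (x == y) = false -> x = y -> P by move=> h /eqP; rewrite h.
  move=> [[i|i]|[i|i]] [[j|j]|[j|j]] E.
  + by rewrite [i]ord1 [j]ord1.
  + exact: nf (fc1 j) (esym E).
  + exact: nf (negPf c12) E.
  + exact: nf (fc21 j) (esym E).
  + exact: nf (fc1 i) E.
  + by rewrite (f1i _ _ E).
  + exact: nf (fc12 i) E.
  + by case: (dis _ _ (f2c j) E).
  + exact: nf (negPf c12) (esym E).
  + exact: nf (fc12 j) (esym E).
  + by rewrite [i]ord1 [j]ord1.
  + exact: nf (fc2 j) (esym E).
  + exact: nf (fc21 i) E.
  + by case: (dis _ _ (f2c i) (esym E)).
  + exact: nf (fc2 i) E.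
  + by rewrite (f2i _ _ E).
- move=> x; have := in_set0 x; rewrite -U0 inE => /negbFE/or4P[/eqP->|/eqP->|/f1P[i <-]|/f2P[i <-]].
  + by exists (inl (inl ord0)).
  + by exists (inr (inl ord0)).
  + by exists (inl (inr i)).
  + by exists (inr (inr i)).
- move=> [[i|i]|[i|i]] [[j|j]|[j|j]]; rewrite /G2g /= /G1c ?[i]ord1 ?[j]ord1 ?eqxx ?orbF ?orbT //=.
  + by rewrite e_sym (pendant_center (f1c j)).
  + by rewrite e_sym ef2.
  + by rewrite (pendant_center (f1c i)).
  + by rewrite e_sym.
  + by rewrite e_sym ef1.
  + by rewrite e_sym (pendant_center (f2c j)).
  + by rewrite e_sym ef.
  + by rewrite (pendant_center (f2c i)).
exists t1, t2; split=> //; [exact: pendant_param_pos f1P pv1 | exact: pendant_param_pos f2P pv2|].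
by rewrite cT !card_sum !card_prod !card_ord.
Qed.
End OneCentre.

Section TwoCentres.
Variables (T : finType) (e : rel T) (d p : nat).
Hypothesis G : extremal e d p.
Let e_sym := ex_sym G.
Let e_irr := ex_irr G.
Hypothesis nc : noncrossing e p.
Hypothesis pE : p = d.*2.+2.

Lemma arms_shift c1 c2 u w : arms e c1 u (c2 :: w) = arms e c2 w (c1 :: u).
Proof. by rewrite [RHS]armsC -!(gpath_pivot e_sym) rev_cons cat_rcons. Qed.

(** The arms have orders d and d + 1. If the longer one does not close at c, the neighbours of its
    end all lie in that arm, so the end sees its d other vertices; the first of these becomes the
    second centre. *)
Lemma lollipop_or_two_centres : (exists c u w, lollipop e d c u w) \/
  exists c1 c2 u w, [/\ arms e c1 u (c2 :: w), size u = d, size w = d,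
    e (last c1 u) c1 & e (last c2 w) c2].
Proof.
have d0 := ex_pos G.
have [c [u [w [A sz wc Nu Nw]]]] := noncrossing_split G nc.
have su := nbrs_size G (mem_last c u) Nu; have sw := nbrs_size G (mem_last c w) Nw.
have [[{}su {}sw]|[{}su {}sw]] :
    (size u = d.+1 /\ size w = d) \/ (size u = d /\ size w = d.+1).
  by move: su sw sz; rewrite /= pE; lia.
- have [uc|uc] := boolP (e (last c u) c); first by left; exists c, u, w.
  right; case: u su uc A Nu {sz} => [//|c1 u] [su] uc A Nu.
  exists c1, c, u, w; split=> //; first by rewrite arms_shift armsC.
  have Nu' y : e (last c1 u) y -> y \in c1 :: u.
    by move=> h; have := Nu y h; rewrite inE => /orP[/eqP E|//]; rewrite -E h in uc.
  apply: (nbrs_full G (mem_last c1 u) Nu'); rewrite ?mem_head //= ?su //.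
  have /armsP[_ _ /and3P[_ h _] _ _] := A; apply: contraNneq h => {1}->.
  by case: (u) su => [|a l _]; [move=> /=; lia | exact: (mem_last a l)].
- by left; exists c, w, u; split=> //; rewrite armsC.
Qed.

Hypothesis nl : ~ exists c u w, lollipop e d c u w.

(** If the end of a rearranged w' were adjacent to c1, then [c2 :: w'] would close up at c1 to a
    lollipop with tail u. *)
Lemma two_centres_clique c1 c2 u w : arms e c1 u (c2 :: w) -> size u = d -> size w = d ->
  e (last c1 u) c1 -> forall v, v \in w -> pendant e d c2 v.
Proof.
move=> A su sw uc; have /armsP[cu c12w Uu Uw uw] := A.
have /andP[c12 c2w] := c12w; have /andP[h1 Uw2] := Uw.
apply: (clique_pendant G c2w Uw2 sw) => w' pw cw' y ly.
have A' : arms e c1 u (c2 :: w').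
  apply/armsP; split=> //=; first by rewrite c12.
    by move: h1 Uw2 => /=; rewrite !inE !(perm_mem pw) (perm_uniq pw) => -> ->.
  by move=> x /uw; rewrite !inE (perm_mem pw).
have sz : size u + size (c2 :: w') = p.-1 by rewrite /= (perm_size pw) su sw pE addnS addnn.
have := noncrossing_arms G nc A' sz uc ly; rewrite inE => /orP[/eqP yc|].
  case: nl; exists c1, (c2 :: w'), u; split=> //=; first by rewrite armsC.
    by rewrite (perm_size pw) sw.
  by rewrite -yc.
by rewrite !inE (perm_mem pw).
Qed.

Lemma uncoveredC c1 c2 : uncovered e d c1 c2 = uncovered e d c2 c1.
Proof. by apply/setP => v; rewrite !inE orbCA; congr (~~ (_ || (_ || _))); rewrite orbC. Qed.

Lemma uncovered_nbr c1 c2 x y : x \in uncovered e d c1 c2 -> e x y ->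
  [|| y == c1, y == c2 | y \in uncovered e d c1 c2].
Proof.
rewrite !inE => /norP[x1 /norP[x2 /norP[p1 p2]]] xy.
case: eqVneq => //= y1; case: eqVneq => //= y2; rewrite negb_or.
apply/andP; split; apply/negP => h.
  by case: (pendant_nbr h (_ : e y x)); rewrite 1?e_sym // => E; rewrite E ?eqxx // in x1 p1.
by case: (pendant_nbr h (_ : e y x)); rewrite 1?e_sym // => E; rewrite E ?eqxx // in x2 p2.
Qed.

(** Uncovered paths from c1 cannot continue to c2, since inserting them between the centres would
    lengthen a longest path. So they stay attached at c1 alone, and [pendant_exists] yields an
    uncovered pendant vertex. *)
Lemma two_centres_edge c1 c2 u w a : arms e c1 u (c2 :: w) -> size u = d -> size w = d ->
  (forall v, v \in u -> pendant e d c1 v) -> (forall v, v \in w -> pendant e d c2 v) ->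
  a \in uncovered e d c1 c2 -> ~~ e c1 a.
Proof.
move=> A su sw pu pw aU; apply/negP => ca.
pose U := uncovered e d c1 c2; have /armsP[cu c12w Uu Uw uw] := A.
have cU : c1 \notin U by rewrite inE eqxx.
have Ux x : x \in U -> [/\ x \notin c1 :: u, x \notin c2 :: w & x != c2].
  rewrite inE => /norP[x1 /norP[x2 /norP[p1 p2]]]; rewrite !inE !negb_or x1 x2; split=> //=.
    by apply: contra p1; apply: pu.
  by apply: contra p2; apply: pw.
have [||v vU pv] := pendant_exists G cU; first by exists a.
  move=> w0 cw0 Uw0 w00 w0U.
  have last_in : last c1 w0 \in U.
    by apply: w0U; case: (w0) w00 => // a' l _; exact: (mem_last a' l).
  have A0 : arms e c1 w0 (c2 :: w) by apply/armsP; split=> // x /w0U/Ux[].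
  split; first by have := arms_bound G A0; rewrite /= sw pE; clear; lia.
  move=> y ly; case/or3P: (uncovered_nbr last_in ly) => [/eqP|/eqP yc|]; [by left| |by right].
  have : arms e c1 u (w0 ++ c2 :: w).
    have /andP[c12 c2w] := c12w.
    apply/armsP; split=> //.
    + by rewrite cat_path cw0 /= -yc ly yc.
    + rewrite -cat_cons cat_uniq Uw0 (_ : uniq (c2 :: w)) ?andbT; last by case/andP: Uw.
      apply/hasPn => x xw; rewrite inE negb_or; apply/andP; split.
        by apply: contraTneq xw => ->; case/andP: Uw.
      by apply: contraL xw => /w0U/Ux[].
    + move=> x xu; rewrite mem_cat negb_or uw // andbT.
      by apply: contraL (xu) => /w0U/Ux[]; rewrite inE negb_or => /andP[].
  move/(arms_bound G); rewrite size_cat /= su sw pE.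
  by case: (w0) w00 => // a' l _ /=; clear; lia.
by move: vU; rewrite inE pv !orbT.
Qed.

Lemma two_centres : exists c1 c2, [/\ e c1 c2, ~~ pendant e d c1 c2, ~~ pendant e d c2 c1,
  (exists v, pendant e d c1 v) /\ (exists v, pendant e d c2 v)
  & uncovered e d c1 c2 = set0].
Proof.
have [//|[c1 [c2 [u [w [A su sw uc wc]]]]]] := lollipop_or_two_centres.
have A' : arms e c2 w (c1 :: u) by rewrite -arms_shift.
have pw := two_centres_clique A su sw uc.
have pu := two_centres_clique A' sw su wc.
have d0 := ex_pos G.
(* The centre b is adjacent to a and to its d clique vertices, whereas a pendant vertex has degree
   d. *)
have npend a b s s' : arms e a s (b :: s') -> size s' = d ->
    (forall v, v \in s' -> pendant e d b v) -> ~~ pendant e d a b.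
  move=> /armsP[_ /andP[ab _] _ Us _] ss ps; apply/negP => /pendant_deg db.
  have : #|a :: s'| <= deg e b.
    apply/subset_leq_card/subsetP => y; rewrite !inE => /orP[/eqP->|/ps/pendant_center].
      by rewrite e_sym.
    by rewrite e_sym.
  have /card_uniqP -> : uniq (a :: s').
    by move: Us; rewrite /= inE => /and3P[/norP[_ ->] _ ->].
  by rewrite db /= ss ltnn.
have ex a (s : seq T) : size s = d -> (forall v, v \in s -> pendant e d a v) -> exists v, pendant e d a v.
  case: s => [|x s] ss ps; first by move: ss d0 => /=; lia.
  by exists x; apply: ps; rewrite mem_head.
exists c1, c2; split.
- by case/armsP: A => _ /andP[].
- exact: npend A sw pw.
- exact: npend A' su pu.
- by split; [exact: ex su pu | exact: ex sw pw].
apply/eqP; apply: contraT => /set0Pn[x xU].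
have [||a [b [aU bU ab]]] := @edge_out _ _ _ _ G (uncovered e d c1 c2) x c1 => //.
  by rewrite inE eqxx.
case/or3P: (uncovered_nbr aU ab) => [/eqP E|/eqP E|h]; last by rewrite h in bU.
  by have := two_centres_edge A su sw pu pw aU; rewrite e_sym -E ab.
by rewrite uncoveredC in aU; have := two_centres_edge A' sw su pw pu aU; rewrite e_sym -E ab.
Qed.

End TwoCentres.

(** * A long block at the centre *)

Section Lollipop.
Variables (T : finType) (e : rel T) (d p : nat).
Hypothesis G : extremal e d p.
Let e_sym := ex_sym G.
Let e_irr := ex_irr G.
Hypothesis nc : noncrossing e p.
Hypothesis pE : p = d.*2.+2.

Lemma maximal_path c (U : {set T}) : c \notin U -> (exists2 v, v \in U & e c v) ->
  exists w, [/\ path e c w, uniq (c :: w), w <> [::], {subset w <= U}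
    & forall y, y \in U -> e (last c w) y -> y \in w].
Proof.
move=> cU [v vU cv].
suff grow n w : #|T| <= size w + n -> path e c w -> uniq (c :: w) -> w <> [::] ->
    {subset w <= U} -> exists w, [/\ path e c w, uniq (c :: w), w <> [::], {subset w <= U}
    & forall y, y \in U -> e (last c w) y -> y \in w].
  apply: (grow #|T| [:: v]); rewrite ?leq_addl //= ?cv // ?inE.
    by rewrite andbT; apply: contraNneq cU => ->.
  by move=> x; rewrite inE => /eqP->.
elim: n w => [|n IH] w sw cw Uw w0 wU.
  have : #|c :: w| <= #|T| by apply: max_card.
  by rewrite (card_uniqP Uw) /=; move: sw; rewrite addn0 => h1 h2; have := leq_trans h2 h1; rewrite ltnn.
have [/existsP[y /and3P[yU ly yw]]|/existsPn H] :=
  boolP [exists y, [&& y \in U, e (last c w) y & y \notin w]].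
  apply: (IH (rcons w y)).
  - by rewrite size_rcons addSnnS.
  - by rewrite rcons_path cw.
  - rewrite -rcons_cons rcons_uniq Uw inE (negPf yw) orbF andbT.
    by apply: contraNneq cU => <-.
  - by case: (w).
  - by move=> x; rewrite mem_rcons inE => /orP[/eqP->|/wU].
exists w; split=> // y yU ly; apply/negPn/negP => yw.
by have := H y; rewrite yU ly yw.
Qed.

Section Fixed.
Variables (c : T) (u w : seq T).
Hypothesis L : lollipop e d c u w.

Lemma lollipop_rev : lollipop e d c (rev u) w.
Proof.
have [A su sw uc] := L; have /armsP[cu cw Uu Uw h] := A.
split; rewrite ?size_rev //; last first.
  case: (u) su cu => // a l _ /= /andP[ca _].
  by rewrite rev_cons last_rcons e_sym.
apply/armsP; split=> //.
- case: (u) cu uc => // a l /= /andP[_ al] lc.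
  rewrite [rev _](_ : _ = last a l :: rev (belast a l)); last by rewrite lastI rev_rcons.
  by rewrite /= e_sym lc rev_path path_flip.
- by move: Uu => /=; rewrite mem_rev rev_uniq.
- by move=> x; rewrite mem_rev => /h.
Qed.

Lemma lollipop_sz : size u + size w = p.-1.
Proof. by have [_ -> -> _] := L; rewrite pE addSn addnn. Qed.

Lemma lollipop_tail : {in w, forall v, pendant e d c v /\ forall y, e v y -> y \in c :: w}.
Proof.
have [A su sw uc] := L => v vw; split; first exact: (noncrossing_clique G nc A lollipop_sz).
by move=> y; rewrite (noncrossing_clique_nbrs G nc A lollipop_sz sw uc) // => /andP[].
Qed.

Lemma lollipop_tail_last : e (last c w) c /\ last c w \in w.
Proof.
have [A su sw uc] := L.
have lw : last c w \in w.
  case: (w) sw => [|a l _]; last exact: (mem_last a l).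
  by move=> /= E; have := ex_pos G; rewrite -E.
by split=> //; have [/pendant_center] := lollipop_tail lw.
Qed.

(** The tail closes at c as well, its last vertex being pendant there; hence u is confined in all
    its arrangements. *)
Lemma lollipop_end u' y : perm_eq u' u -> path e c u' -> e (last c u') y -> y \in c :: u.
Proof.
move=> pu cu' ly; have [A su sw uc] := L; have [lc _] := lollipop_tail_last.
have sz := lollipop_sz; rewrite addnC in sz; rewrite armsC in A.
exact: (noncrossing_end G nc A sz lc pu cu' ly).
Qed.

(** Reversing u from v onwards, through the edge between its last vertex and the predecessor of v,
    turns v into an end. *)
Lemma lollipop_pred u1 v u2 y : u = u1 ++ v :: u2 -> e (last c u) (last c u1) ->
  e v y -> y \in c :: u.
Proof.
move=> E ll vy; have [A su sw uc] := L; have /armsP[cu _ _ _ _] := A.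
apply: (@lollipop_end (u1 ++ rev (v :: u2))); last by rewrite last_cat rev_cons last_rcons.
  by rewrite E perm_cat2l perm_rev.
have /andP[cu1 /andP[_ vu2]] : path e c u1 && path e (last c u1) (v :: u2) by rewrite -cat_path -E.
have -> : rev (v :: u2) = last v u2 :: rev (belast v u2) by rewrite [in LHS]lastI rev_rcons.
rewrite cat_path cu1 andTb; apply/andP; split.
  by rewrite e_sym; move: ll; rewrite {1}E last_cat.
by rewrite -/(path e _ _) rev_path path_flip.
Qed.

(** An excursion from q off the cycle is measured against both directions around the cycle and
    against the degree of its last vertex; only d = 2, with q in the middle of u, survives. *)
Lemma lollipop_open q z : q \in u -> e q z -> z \notin c :: u ->
  (exists a b, u = [:: a; q; b]) /\ d = 2 /\
  {in u, forall v, v != q -> forall y, e v y -> y \in c :: u}.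
Proof.
move=> qu qz zL; have [A su sw uc] := L; have /armsP[cu cw Uu Uw h] := A.
(* Among the d + 2 vertices of [c :: u], the last one misses itself and at most one more. By
   [lollipop_pred] it misses the predecessor of q; missing that of v as well would make three. *)
have others : {in u, forall v, v != q -> forall y, e v y -> y \in c :: u}.
  move=> v vu vq y vy.
  have pred x : x \in u -> exists u1 u2, u = u1 ++ x :: u2.
    by case/splitPr=> u1 u2; exists u1, u2.
  have [q1 [q2 Eq]] := pred q qu; have [v1 [v2 Ev]] := pred v vu.
  have lq : ~~ e (last c u) (last c q1) by apply: contra zL => h'; exact: lollipop_pred Eq h' qz.
  have [lv|lv] := boolP (e (last c u) (last c v1)); first exact: lollipop_pred Ev lv vy.
  have lu : last c u \in u.
    by case: (u) qu => // a l _; exact: (mem_last a l).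
  have in1 x x1 x2 : u = x1 ++ x :: x2 -> last c x1 \in c :: u /\ last c x1 != last c u.
    move=> E; split.
      by have := mem_last c x1; rewrite !inE E mem_cat => /orP[->//|->]; rewrite orbT.
    rewrite E last_cat; have : last x x2 \in x :: x2 by exact: mem_last.
    have := Uu; rewrite E -cat_cons cat_uniq => /and3P[_ /hasPn hh _] /hh.
    by apply: contraNneq; rewrite /= => <-; exact: mem_last.
  have neq : last c q1 != last c v1.
    apply: contra vq => /eqP E.
    have ix x x1 x2 : u = x1 ++ x :: x2 -> index x (c :: u) = (index (last c x1) (c :: u)).+1.
      move=> E1; have Ux : uniq ((c :: x1) ++ x :: x2) by rewrite cat_cons -E1.
      have E2 : c :: u = (c :: x1) ++ x :: x2 by rewrite E1.
      rewrite E2 !index_cat mem_last.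
      have -> : x \in c :: x1 = false.
        move: Ux; rewrite cat_uniq => /and3P[_ /hasPn/(_ x)]; rewrite mem_head => /(_ isT) /negbTE.
        by [].
      have -> : index x (x :: x2) = 0 by rewrite /= eqxx.
      by rewrite index_last ?addn0 //; move: Ux; rewrite cat_uniq => /and3P[].
    have := ix _ _ _ Eq; rewrite E -(ix _ _ _ Ev) => Ei.
    apply/eqP; rewrite -(nth_index c (_ : v \in c :: u)) ?inE ?vu ?orbT //.
    by rewrite -Ei nth_index // inE qu orbT.
  have [i1 n1] := in1 _ _ _ Eq; have [i2 n2] := in1 _ _ _ Ev.
  have s3 : uniq [:: last c u; last c q1; last c v1].
    by rewrite /= !inE !(eq_sym (last c u)) (negPf n1) (negPf n2) (negPf neq).
  have ss : {subset [:: last c u; last c q1; last c v1] <= c :: u}.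
    by move=> x; rewrite 3!in_cons in_nil => /or3P[/eqP->|/eqP->|/orP[/eqP->|//]] //; exact: mem_last.
  have ne y' : y' \in [:: last c u; last c q1; last c v1] -> ~~ e (last c u) y'.
    by rewrite !inE => /or3P[] /eqP-> //; rewrite e_irr.
  have := nbrs_missing G s3 ss (mem_head _ _) (fun y' => @lollipop_end u y' (perm_refl u) cu) ne.
  by rewrite /= su addn3 ltnn.
pose U := ~: [set y in c :: u ++ w].
have zw : z \notin w.
  apply/negP => /lollipop_tail[_ /(_ q)]; rewrite e_sym => /(_ qz).
  rewrite inE => /orP[/eqP E|]; last by apply/negP/h.
  by move: Uu; rewrite -E /= qu.
have zU : z \in U.
  by move: zL; rewrite !inE mem_cat !negb_or zw andbT.
have qU : q \notin U by rewrite !inE mem_cat qu orbT.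
have [|w' [qw' Uw' w'0 w'U w'm]] := maximal_path qU; first by exists z.
(* Leaving the cycle at q and following w' gives an arm that must fit against the tail of order
   d. *)
have bound u1 q' u2 : lollipop e d c (u1 ++ q' :: u2) w -> q' = q -> perm_eq (u1 ++ q' :: u2) u ->
    size u1 + size w' <= d.
  move=> [A' _ _ _] E pu; subst q'; have /armsP[cu' _ Uu' _ h'] := A'.
  have : arms e c (u1 ++ q :: w') w.
    apply/armsP; split=> //.
    - by move: cu'; rewrite !cat_path /= qw' => /and3P[-> ->].
    - have E : c :: u1 ++ q :: w' = (c :: rcons u1 q) ++ w' by rewrite /= cat_rcons.
      rewrite E cat_uniq; apply/and3P; split.
      + by move: Uu'; rewrite -cat_rcons -cat_cons cat_uniq => /and3P[].
      + apply/hasPn => x /w'U; rewrite !inE mem_cat !negb_or => /and3P[xc xu _].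
        rewrite /= xc /=; apply: contra xu => xu.
        by rewrite -(perm_mem pu) -cat_rcons mem_cat xu.
      + by case/andP: Uw'.
    - move=> x; rewrite -cat_rcons mem_cat => /orP[xu|/w'U].
        by apply: h'; rewrite -cat_rcons mem_cat xu.
      by rewrite !inE mem_cat !negb_or => /and3P[].
  by move/(arms_bound G); rewrite size_cat /= sw pE; clear; lia.
have [u1 [u2 E]] : exists u1 u2, u = u1 ++ q :: u2 by case/splitPr: qu => u1 u2; exists u1, u2.
have b1 : size u1 + size w' <= d by apply: (bound u1 q u2); rewrite -?E.
have b2 : size u2 + size w' <= d.
  have := bound (rev u2) q (rev u1); rewrite size_rev.
  have -> : rev u2 ++ q :: rev u1 = rev u by rewrite E rev_cat rev_cons cat_rcons.
  by apply=> //; [exact: lollipop_rev | rewrite perm_rev].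
have lw' : last q w' \in w' by case: (w') w'0 => // a l _; exact: (mem_last a l).
have b3 : d < size [:: c, q & w'].
  apply: (nbrs_size G (z := last q w')); first by rewrite !inE lw' !orbT.
  move=> y ly; have [yU|] := boolP (y \in U); first by rewrite !inE (w'm _ yU ly) !orbT.
  have lU := w'U _ lw'; rewrite !inE negbK mem_cat => /or3P[->//|yu|yw].
    have [->|yq] := eqVneq y q; first by rewrite orbT.
    have := others y yu yq (last q w'); rewrite e_sym => /(_ ly) hh.
    by move: lU; rewrite !inE mem_cat; move: hh; rewrite inE => /orP[->|->] //; rewrite orbT.
  have [_ /(_ (last q w'))] := lollipop_tail yw; rewrite e_sym => /(_ ly) hh.
  by move: lU; rewrite !inE mem_cat; move: hh; rewrite inE => /orP[->|->] //; rewrite !orbT.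
have b4 : size u1 + size u2 = d by move: su; rewrite E size_cat /= addnS => -[].
have b5 : 0 < size w' by case: (w') w'0.
(* The two directions add up to [2 * size w' <= d], and the degree of the last vertex of w' gives
   [d <= size w' + 1]; as w' is nonempty, d = 2. *)
have [d2 s1 s2] : [/\ d = 2, size u1 = 1 & size u2 = 1].
  by move: b1 b2 b3 b4 b5 => /=; clear; move: (size u1) (size u2) (size w') => *; split; lia.
split; last by split.
case: u1 s1 E {b1 b4} => [|a [|? ?]] // _; case: u2 s2 {b2} => [|b [|? ?]] // _ /= E.
by exists a, b.
Qed.

End Fixed.
End Lollipop.

(** * Recognising G_3, G_4 and G_5 *)

Lemma isomorphic_mindeg (T1 T2 : finType) (e1 : rel T1) (e2 : rel T2) d :
  isomorphic e1 e2 -> mindeg_ge e1 d -> mindeg_ge e2 d.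
Proof.
move=> [f [[g fK gK] fe]] md y; apply: leq_trans (md (g y)) _.
rewrite /deg -(card_imset _ (can_inj fK)); apply/subset_leq_card/subsetP => z.
by case/imsetP=> x; rewrite inE => h ->; rewrite inE -(gK y) fe.
Qed.

Lemma spanning_cycle_no_cut (T : finType) (e : rel T) (s : seq T) :
  symmetric e -> gcycle e s -> (forall x, x \in s) -> no_cut_vertex e.
Proof.
move=> e_sym Gs all v x y xv yv.
have [r [cr Pr _]] := gcycle_rot Gs (all v).
have Ur : uniq (v :: r) by rewrite (perm_uniq Pr); case/andP: Gs.
have inr z : z != v -> z \in r.
  by move=> zv; have := all z; rewrite -(perm_mem Pr) inE (negPf zv).
case: r cr Ur inr {Pr} => [|a r] cr Ur inr; first by have := inr x xv.
have ar : path (avoid e v) a r.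
  move: cr Ur => /= /andP[_]; rewrite inE negb_or => + /and3P[/andP[va +] _ _].
  elim: r a va {inr} => //= b r IH a va /andP[ab br]; rewrite inE negb_or => /andP[vb vr].
  by rewrite /avoid ab eq_sym va eq_sym vb IH.
have co z : z != v -> connect (avoid e v) a z by move=> /inr; exact: (path_connect ar).
apply: connect_trans (co y yv); rewrite sym_connect_sym ?co //.
by move=> z1 z2; rewrite /avoid e_sym andbA andbAC -andbA.
Qed.

(** K will be the exceptional part. Parametrising what lies off K, not all pendant vertices, makes
    the cliques disjoint from K by construction. *)
Lemma pendant_param_off (T : finType) (e : rel T) d c (K : {set T}) :
  symmetric e -> (forall v, v != c -> v \notin K -> pendant e d c v) ->
  (forall x y, x \in K -> y \notin K -> e x y -> y = c) ->
  exists t (f : 'I_t * 'I_d -> T),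
  [/\ injective f, forall v, v != c /\ v \notin K <-> exists i, f i = v
    & forall i j, e (f i) (f j) = copiesg t (completeg d) i j].
Proof.
move=> e_sym H HK.
have [|t [f [fi fD fe]]] := @clique_classes T e [set v | (v != c) && (v \notin K)] d.
  move=> x; rewrite inE => /andP[xc xK].
  have /pendantP[W [xW cW dW HW]] := H x xc xK; exists W; split=> //.
    apply/subsetP => y yW; rewrite inE; apply/andP; split; first by apply: contraNneq cW => <-.
    apply/negP => yK; have [yx|yx] := eqVneq y x; first by rewrite yx (negPf xK) in yK.
    have : e y x by rewrite e_sym HW // !inE yW orbT.
    by move/(HK _ _ yK xK) => E; rewrite E eqxx in xc.
  move=> x' y x'W; rewrite inE => /andP[yc _].
  by rewrite HW // !inE (negPf yc).
exists t, f; split=> // v; rewrite -fD inE; split; [by case=> -> ->|by case/andP].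
Qed.

Section Shapes.
Variables (T : finType) (e : rel T).
Hypothesis e_sym : symmetric e.
Hypothesis e_irr : irreflexive e.

(** B is the graph induced on [c :: u]; the spanning cycle makes it connected and free of cut
    vertices. *)
Lemma spanned_G3 k m c u : ~ has_Km e m -> mindeg_ge e (delta k) ->
  gcycle e (c :: u) -> size u = (delta k).+1 ->
  (forall v, v != c -> v \notin u -> pendant e (delta k) c v) ->
  (forall x y, x \in u -> y \notin u -> e x y -> y = c) ->
  isG3 e #|T| k m.
Proof.
set d := delta k => nK md Gc su H Hu.
have [Uc Cc] := andP Gc; have /andP[cu Uu] := Uc.
have [t [f [fi fD fe]]] := @pendant_param_off T e d c [set y in u] e_sym
  (fun v vc vu => H v vc (ltac:(by rewrite inE in vu)))
  (fun x y => ltac:(by rewrite !inE; exact: Hu)).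
have fcK i : f i != c /\ f i \notin u.
  by have [|h1 h2] := (fD (f i)).2; [exists i | split=> //; rewrite inE in h2].
have fp i : pendant e d c (f i) by have [h1 h2] := fcK i; apply: H.
pose h (o : option 'I_d.+1) := if o is Some i then nth c u i else c.
have hin (i : 'I_d.+1) : nth c u i \in u by rewrite mem_nth // su.
have hi : injective h.
  move=> [i|] [j|] //= E.
  - by congr Some; apply/val_inj/eqP; rewrite -(nth_uniq c _ _ Uu) ?su ?ltn_ord // E.
  - by have := hin i; rewrite E (negPf cu).
  - by have := hin j; rewrite -E (negPf cu).
pose B x y := e (h x) (h y).
have hB : map h (None :: map Some (enum 'I_d.+1)) = c :: u.
  by rewrite /= -map_comp; congr cons; rewrite -[RHS](mkseq_nth c) su /mkseq -val_enum_ord -map_comp.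
have allB x : x \in None :: map Some (enum 'I_d.+1).
  by case: x => [i|]; rewrite !inE //= map_f ?mem_enum.
have GB : gcycle B (None :: map Some (enum 'I_d.+1)).
  rewrite /gcycle; apply/andP; split; first by rewrite -(map_inj_uniq hi) hB.
  have := Cc; rewrite -hB; move: (None :: _) => s.
  by case: s => //= x s; rewrite -map_rcons path_map.
have sB : simple_graph B by split=> [x y|x]; [exact: e_sym | exact: e_irr].
have [|||I cT] := @isomorphic_of_param T (G3T t d) e (G3g t B)
    (fun s => match s with None => c | Some (inl i) => f i | Some (inr a) => nth c u a end).
- have nf i (j : 'I_d.+1) : f i = nth c u j -> False by move=> E; have [_ +] := fcK i; rewrite E hin.
  move=> [[i|i]|] [[j|j]|] E //.
  + by rewrite (fi _ _ E).
  + by case: (nf _ _ E).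
  + by have [] := fcK i; rewrite E eqxx.
  + by case: (nf _ _ (esym E)).
  + by have /= -[->] := @hi (Some i) (Some j) E.
  + by have := @hi (Some i) None E.
  + by have [] := fcK j; rewrite -E eqxx.
  + by have := @hi None (Some j) E.
- move=> x; have [->|xc] := eqVneq x c; first by exists None.
  have [xu|xu] := boolP (x \in u).
    have xi : index x u < d.+1 by rewrite -su index_mem.
    by exists (Some (inr (Ordinal xi))); rewrite /= nth_index.
  have /fD[i <-] : x != c /\ x \notin [set y in u] by rewrite inE.
  by exists (Some (inl i)).
- have fu i (a : 'I_d.+1) : e (f i) (nth c u a) = false.
    have [h1 h2] := fcK i; apply/negP; rewrite e_sym => /(Hu _ _ (hin a) h2) E.
    by rewrite E eqxx in h1.
  move=> [[i|i]|] [[j|j]|] //=.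
  + by rewrite fe; case: i j => [i a] [j b].
  + by rewrite fu; case: i.
  + by rewrite (pendant_center (fp i)); case: i.
  + by rewrite e_sym fu.
  + by rewrite e_sym (pendant_center (fp j)).
exists t, B; split=> //; last exact: isomorphic_mindeg I md.
  by rewrite cT card_option card_sum card_prod !card_ord; lia.
split=> //; first by move=> x y; case/andP: GB => _ /connect_cycle; apply.
  by apply: spanning_cycle_no_cut GB allB; case: sB.
move=> [S [cS clS]]; apply: nK; exists (h @: S); split; first by rewrite card_imset.
move=> _ _ /imsetP[x xS ->] /imsetP[y yS ->] xy; apply: clS => //.
by apply: contraNneq xy => ->.
Qed.

(** The neighbours of q other than c become the leaves of the star and q its centre; adjacency of c
    and q decides between G_5 and G_4. *)
Lemma fan_G45 c q : c != q -> (exists v, [/\ v != c, v != q & ~~ e q v]) ->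
  (forall y, y != c -> e q y -> forall z, e y z = (z == c) || (z == q)) ->
  (exists a b, [/\ a != b, a != c, b != c, e q a & e q b]) ->
  (forall v, [|| v == c, v == q, e q v | pendant e 2 c v]) ->
  isG4 e #|T| \/ isG5 e #|T|.
Proof.
move=> cq pv HI [a [b [ab ac bc qa qb]]] cov.
pose I := [set y | (y != c) && e q y].
have [t [f [fi fD fe]]] : exists t (f : 'I_t * 'I_2 -> T),
    [/\ injective f, forall v, v != c /\ v \notin q |: I <-> exists i, f i = v
    & forall i j, e (f i) (f j) = copiesg t (completeg 2) i j].
  apply: pendant_param_off => //.
    move=> v vc; rewrite !inE vc => /norP[vq /= vI]; have := cov v.
    by rewrite (negPf vc) (negPf vq) (negPf vI).
  move=> x y; rewrite !inE => /orP[/eqP->|/andP[xc qx]] /norP[yq yI] xy.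
    by move: yI; rewrite xy andbT negbK => /eqP.
  by move: xy; rewrite (HI x xc qx) (negPf yq) orbF => /eqP.
have fcK i : f i != c /\ f i \notin q |: I by apply/fD; exists i.
have fp i : pendant e 2 c (f i).
  have [h1] := fcK i; rewrite !inE h1 => /norP[h2 /= h3]; have := cov (f i).
  by rewrite (negPf h1) (negPf h2) (negPf h3).
(* The count [n2] includes q and the shared centre c besides the leaves; a and b ensure
   [4 <= n2]. *)
pose n2 := #|I| + 2.
have cI : #|I| = n2 - 2 by rewrite addnK.
have n24 : 4 <= n2.
  have : #|[set a; b]| <= #|I|.
    by apply/subset_leq_card/subsetP => x; rewrite !inE => /orP[/eqP->|/eqP->]; apply/andP.
  by rewrite cards2 ab /n2; clear; lia.
have [h [hi hI]] := set_param cI.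
have hin i : (h i != c) && e q (h i) by have : h i \in I; [apply/hI; exists i | rewrite inE].
have t0 : 0 < t.
  have [v [vc vq qv]] := pv; suff /fD[[i _] _] : v != c /\ v \notin q |: I by apply: leq_ltn_trans (ltn_ord i).
  by rewrite !inE (negPf vq) (negPf qv) andbF.
pose g (s : G45T t (n2 - 2)) := match s with inl (inl _) => c | inl (inr i) => f i
   | inr None => q | inr (Some j) => h j end.
have hq i : h i != q by apply: contraTneq (hin i) => ->; rewrite e_irr andbF.
have fq i : f i != q by have [_] := fcK i; rewrite !inE negb_or => /andP[].
have fh i j : f i = h j -> False.
  by move=> E; have [_] := fcK i; rewrite !inE E (hin j) orbT.
have fc i : f i != c by have [] := fcK i.
have hc i : h i != c by have /andP[] := hin i.
have qh i : e q (h i) by have /andP[] := hin i.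
have nf (x y : T) (P : Prop) : x != y -> x = y -> P by move=> h' E; rewrite E eqxx in h'.
have gi : injective g.
  move=> [[i|i]|[i|]] [[j|j]|[j|]] E //=.
  + by rewrite [i]ord1 [j]ord1.
  + exact: nf (fc j) (esym E).
  + exact: nf (hc j) (esym E).
  + exact: nf cq E.
  + exact: nf (fc i) E.
  + by rewrite (fi _ _ E).
  + by case: (fh _ _ E).
  + exact: nf (fq i) E.
  + exact: nf (hc i) E.
  + by case: (fh _ _ (esym E)).
  + by rewrite (hi _ _ E).
  + exact: nf (hq i) E.
  + exact: nf cq (esym E).
  + exact: nf (fq j) (esym E).
  + exact: nf (hq j) (esym E).
have gs x : exists s, g s = x.
  have [->|xc] := eqVneq x c; first by exists (inl (inl ord0)).
  have [->|xq] := eqVneq x q; first by exists (inr None).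
  have [/hI[i <-]|xI] := boolP (x \in I); first by exists (inr (Some i)).
  have /fD[i <-] : x != c /\ x \notin q |: I by rewrite in_setU1 (negPf xq).
  by exists (inl (inr i)).
have hN i z : e (h i) z = (z == c) || (z == q) by apply: HI.
have fqN i : e (f i) q = false.
  by apply/negP; rewrite e_sym => qf; have [_] := fcK i; rewrite !inE qf (fc i) orbT.
have fhN i j : e (f i) (h j) = false by rewrite e_sym hN (negPf (fc i)) (negPf (fq i)).
have fcN i : e (f i) c by exact: pendant_center (fp i).
have cE (i : 'I_1) : (inl i == G1c t 2) = true by rewrite [i]ord1 eqxx.
have G4 : e c q = false -> forall i j, e (g i) (g j) = G4g t (n2 - 2) i j.
  move=> ecq [[i|i]|[i|]] [[j|j]|[j|]]; rewrite /G4g /= ?cE ?orbF ?hN ?fe ?fcN ?fqN ?fhN ?qh ?ecq ?e_irr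
     ?eqxx ?orbT ?(negPf (fc _)) ?(negPf (hc _)) ?(negPf (fq _)) ?(negPf (hq _)) //.
  + by rewrite /completeg [i]ord1 [j]ord1 eqxx.
  + by rewrite e_sym fcN.
  + by rewrite e_sym hN eqxx.
  + by rewrite e_sym ecq.
  + by rewrite e_sym fqN.
have G5 : e c q -> forall i j, e (g i) (g j) = G5g t (n2 - 2) i j.
  move=> ecq [[i|i]|[i|]] [[j|j]|[j|]]; rewrite /G5g /= ?cE ?orbF ?hN ?fe ?fcN ?fqN ?fhN ?qh ?ecq ?e_irr
     ?eqxx ?orbT ?(negPf (fc _)) ?(negPf (hc _)) ?(negPf (fq _)) ?(negPf (hq _)) //.
  + by rewrite /completeg [i]ord1 [j]ord1 eqxx.
  + by rewrite e_sym fcN.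
  + by rewrite e_sym hN eqxx.
  + by rewrite e_sym ecq.
  + by rewrite e_sym fqN.
have cM : #|T| = (1 + t * 2) + n2 - 1.
  have [_ ->] := @isomorphic_of_param _ _ e (fun i j => e (g i) (g j)) g gi gs (fun _ _ => erefl).
  rewrite !card_sum card_option card_prod !card_ord.
  by move: n24; move: (n2); clear; lia.
have [ecq|ecq] := boolP (e c q); [right|left]; exists t, (1 + t * 2), n2; split=> //.
  by have [] := isomorphic_of_param gi gs (G5 ecq).
by have [] := isomorphic_of_param gi gs (G4 (negbTE ecq)).
Qed.
End Shapes.

Section LollipopShape.
Variables (T : finType) (e : rel T) (k m p : nat).
Let d := delta k.
Hypothesis G : extremal e d p.
Let e_sym := ex_sym G.
Let e_irr := ex_irr G.
Hypothesis nc : noncrossing e p.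
Hypothesis pE : p = d.*2.+2.
Variables (c : T) (u w : seq T).
Hypothesis L : lollipop e d c u w.

Lemma lollipop_closed : ~ has_Km e m -> {in u, forall v y, e v y -> y \in c :: u} ->
  isG3 e #|T| k m.
Proof.
move=> nK cl; have [A su sw uc] := L; have /armsP[cu cw Uu Uw uw] := A.
have cov v : [|| v == c, v \in [set y in u] | pendant e d c v].
  apply: (pendant_cover G) => [x y|w' cw' Uw' Hw'].
    by rewrite !inE => xu yu /(cl x xu); rewrite inE (negPf yu) orbF => /eqP; left.
  have : arms e c u w'.
    by apply/armsP; split=> // x xu; apply/negP => /Hw'[]; rewrite inE xu.
  by move/(arms_bound G); rewrite su pE; clear; lia.
apply: (spanned_G3 e_sym e_irr (c := c) (u := u)) => //.
- exact: ex_deg G.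
- by rewrite /gcycle Uu /= rcons_path cu.
- by move=> v vc vu; have := cov v; rewrite inE (negPf vc) (negPf vu).
- by move=> x y xu yu /(cl x xu); rewrite inE (negPf yu) orbF => /eqP.
Qed.

Lemma lollipop_fan q z : q \in u -> e q z -> z \notin c :: u ->
  d = 2 /\ (isG4 e #|T| \/ isG5 e #|T|).
Proof.
move=> qu qz zL; have [[a [b E]] [d2 others]] := lollipop_open G nc pE L qu qz zL.
have [A su sw uc] := L; have /armsP[cu cw Uu Uw uw] := A.
split=> //; move: cu Uu; rewrite E /= !inE => /and4P[ca aq qb _].
rewrite !negb_or !andbT => /andP[/and3P[Dca Dcq Dcb] /andP[/andP[Daq Dab] Dqb]].
have bc : e b c by move: uc; rewrite E.
have Na : forall y, e a y -> y \in [:: c; a; q; b].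
  by rewrite -E; apply: others; rewrite // E !inE eqxx.
have Nb : forall y, e b y -> y \in [:: c; a; q; b].
  by rewrite -E; apply: others; rewrite 1?eq_sym // E !inE eqxx !orbT.
(* Otherwise a, b, q is another arrangement of u, ending at q, and z would be confined. *)
have nab : ~~ e a b.
  apply/negP => ab; have := @lollipop_end _ _ _ _ G nc pE c u w L [:: a; b; q] z.
  rewrite /= ca ab (e_sym b) qb qz => h; have := zL; rewrite h //.
  by rewrite E perm_cons; apply/permPl; exact: (perm_catC [:: b] [:: q]).
have wN x : x \in w -> forall y, e x y -> y \in c :: w by move=> /(lollipop_tail G nc pE L)[].
have qw x : x \in w -> e q x = false.
  move=> xw; apply/negP; rewrite e_sym => /(wN x xw); rewrite inE eq_sym (negPf Dcq) /=.
  by apply/negP/uw; rewrite E !inE eqxx orbT.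
have HI y : y != c -> e q y -> forall z, e y z = (z == c) || (z == q).
  move=> yc qy.
  have Ny z' : e y z' -> z' \in [:: y; c; q].
    have [->|ya] := eqVneq y a.
      by move=> /[dup] az /Na; rewrite !inE => /or4P[->|->|->|/eqP zb]; rewrite ?orbT //;
         rewrite zb (negPf nab) in az.
    have [->|yb] := eqVneq y b.
      by move=> /[dup] bz /Nb; rewrite !inE => /or4P[->|/eqP zb|->|->]; rewrite ?orbT //;
         rewrite zb e_sym (negPf nab) in bz.
    move=> yz'; rewrite !inE; apply/negPn/negP; rewrite !negb_or => /and3P[z'y z'c z'q].
    have yw : y \notin w by apply: contraTN qy => /qw ->.
    have z'w : z' \notin w.
      by apply: contra yw => z'w; have := wN z' z'w y; rewrite e_sym inE (negPf yc); apply.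
    have z'b : z' != b.
      by apply: contraTneq yz' => ->; rewrite e_sym; apply/negP => /Nb;
        rewrite !inE (negPf yc) (negPf ya) (negPf yb) !orbF => /eqP yq; rewrite yq e_irr in qy.
    have yq : y != q by apply: contraTneq qy => ->; rewrite e_irr.
    (* This arm has d + 2 = 4 vertices, too many against the tail w. *)
    have : arms e c [:: b; q; y; z'] w.
      apply/armsP; split=> //.
      - by rewrite /= (e_sym c) bc (e_sym b) qb qy yz'.
      - rewrite /= !inE !negb_or Dcb Dcq (eq_sym c y) yc (eq_sym c z') z'c.
        by rewrite (eq_sym b q) Dqb (eq_sym b y) yb (eq_sym b z') z'b (eq_sym q) yq
          (eq_sym q) z'q (eq_sym y) z'y.
      - move=> x; rewrite !inE => /or4P[/eqP->|/eqP->|/eqP->|/eqP->] //; apply: uw;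
          by rewrite E !inE eqxx ?orbT.
    by move/(arms_bound G); rewrite /= sw pE d2.
  have yq : y != q by apply: contraTneq qy => ->; rewrite e_irr.
  have full := nbrs_full G (mem_head y [:: c; q]) Ny (ltac:(by rewrite d2)).
  move=> z'; apply/idP/idP => [yz'|].
    have := Ny z' yz'; rewrite !inE => /or3P[/eqP zy|->|->]; rewrite ?orbT //.
    by rewrite zy e_irr in yz'.
  by case/orP=> /eqP->; apply: full; rewrite ?inE ?eqxx ?orbT // eq_sym.
have cov v : [|| v == c, v \in [set y | (y == q) || ((y != c) && e q y)] | pendant e d c v].
  apply: (pendant_cover G) => [x y|w' cw' Uw' Hw'].
    rewrite !inE => /orP[/eqP->|/andP[xc qx]] /norP[yq]; rewrite negb_and negbK.
      by move=> /orP[/eqP|/negP h]; [left | move/h].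
    by move=> _; rewrite (HI x xc qx) (negPf yq) orbF => /eqP; left.
  have : arms e c u w'.
    apply/armsP; split=> //; rewrite E /=.
    - by rewrite ca aq qb.
    - by rewrite !inE !negb_or Dca Dcq Dcb Daq Dab Dqb.
    - move=> x; rewrite !inE => xu; apply/negP => /Hw'[]; rewrite inE => /negP[].
      case/or3P: xu => /eqP->; rewrite ?eqxx //.
        by rewrite (eq_sym a c) Dca e_sym aq orbT.
      by rewrite (eq_sym b c) Dcb qb orbT.
  by move/(arms_bound G); rewrite su pE d2; clear; lia.
apply: (fan_G45 e_sym e_irr Dcq) => //.
- have [_ lw] := lollipop_tail_last G nc pE L; exists (last c w); split.
  + by apply: contraTneq lw => ->; case/andP: Uw.
  + by apply: contraTneq lw => ->; apply: uw; rewrite E !inE eqxx orbT.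
  + by rewrite qw.
- by exists a, b; split; rewrite // 1?eq_sym // e_sym.
- move=> v; have := cov v; rewrite inE d2.
  by case: (v == c); case: (v == q); case: (e q v).
Qed.

Lemma lollipop_shape : ~ has_Km e m ->
  isG3 e #|T| k m \/ (d = 2 /\ (isG4 e #|T| \/ isG5 e #|T|)).
Proof.
move=> nK.
have [/existsP[q /existsP[z /and3P[qu qz zL]]]|/existsPn H] :=
  boolP [exists q, exists z, [&& q \in u, e q z & z \notin c :: u]].
  by right; exact: lollipop_fan qu qz zL.
left; apply: lollipop_closed nK _ => v vu y vy; apply/negPn/negP => yu.
by have /existsPn/(_ y) := H v; rewrite vu vy yu.
Qed.

Lemma lollipop_pendant : exists v, pendant e d c v.
Proof.
have [_ lw] := lollipop_tail_last G nc pE L.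
by exists (last c w); have [] := lollipop_tail G nc pE L lw.
Qed.
End LollipopShape.

(** * An edge off a cycle of order 2d *)

Section OffEdge.
Variables (T : finType) (e : rel T) (d p : nat).
Hypothesis G : extremal e d p.
Let e_sym := ex_sym G.
Let e_irr := ex_irr G.
Hypothesis pE : p = d.*2.+2.
Hypothesis nC : forall s, gcycle e s -> size s <> d.*2.+1.

Section Cycle.
Variable C : seq T.
Hypothesis GC : gcycle e C.
Hypothesis sC : size C = d.*2.

(** C opened at c and prolonged by t and s is a path of order 2d + 2 = p, hence a longest path
    ending at s. *)
Lemma off_edge_nbr s t c y : s \notin C -> t \notin C -> e s t -> c \in C -> e t c ->
  e s y -> y = t \/ y \in C.
Proof.
move=> sN tN st cC tc sy.
have [r [cr Pr _]] := gcycle_rot GC cC.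
have A : arms e c r [:: t; s].
  apply/armsP; split=> //.
  - by rewrite /= e_sym tc e_sym st.
  - by rewrite (perm_uniq Pr); case/andP: GC.
  - rewrite /= !inE negb_or andbT; apply/andP; split.
      by apply/andP; split; [apply: contraNneq tN => <- | apply: contraNneq sN => <-].
    by apply: contraTneq st => ->; rewrite e_irr.
  - move=> x xr; have xC : x \in C by rewrite -(perm_mem Pr) inE xr orbT.
    by rewrite !inE negb_or; apply/andP; split;
      [apply: contraNneq tN => <- | apply: contraNneq sN => <-].
have sz : size r + size [:: t; s] = p.-1.
  by have := perm_size Pr; rewrite sC pE /= => <-; rewrite addn2.
have := longest_arms G A sz sy; rewrite -cat_cons mem_cat (perm_mem Pr) !inE.
by case/or3P=> [|/eqP|/eqP ys]; [right | left | rewrite ys e_irr in sy].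
Qed.

(** Inserting s after c would give a cycle of order 2d + 1. *)
Lemma off_edge_next1 s c : s \notin C -> c \in C -> e s c -> ~~ e s (next C c).
Proof.
move=> sN cC sc; apply/negP => sn.
have [r [cr Pr lr]] := gcycle_span e_sym GC cC.
have : gcycle e (s :: c :: r).
  rewrite /gcycle cons_uniq (perm_mem Pr) sN (perm_uniq Pr); case/andP: GC => -> _.
  by rewrite /= sc rcons_path cr lr e_sym sn.
by move/nC; rewrite /= -sC -(perm_size Pr).
Qed.

(** Inserting the edge after c would give a cycle of order p. *)
Lemma off_edge_next2 s t c : s \notin C -> t \notin C -> e s t -> c \in C -> e s c ->
  ~~ e t (next C c).
Proof.
move=> sN tN st cC sc; apply/negP => tn.
have [r [cr Pr lr]] := gcycle_span e_sym GC cC.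
have : gcycle e (t :: s :: c :: r).
  rewrite /gcycle 2!cons_uniq in_cons !(perm_mem Pr) sN (negPf tN) (perm_uniq Pr).
  case/andP: GC => -> _; rewrite orbF !andbT; apply/andP; split.
    by apply: contraTneq st => ->; rewrite e_irr.
  by rewrite /= e_sym st sc rcons_path cr lr e_sym tn.
move/(gcycle_bound G) => /(_ isT); have := perm_size Pr; rewrite sC /= => ->.
by rewrite pE ltnn.
Qed.

(** Substituting the edge for the successor of c would give a cycle of order 2d + 1. *)
Lemma off_edge_next3 s t c : s \notin C -> t \notin C -> e s t -> c \in C -> e s c ->
  ~~ e t (next C (next C c)).
Proof.
move=> sN tN st cC sc; apply/negP => tn; have [UC _] := andP GC.
have [|r [cr Pr lr]] := gcycle_span2 e_sym GC cC.
  by move: (ex_pos G); rewrite sC; clear; lia.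
have sub x : x \notin C -> x \notin c :: r by rewrite -(perm_mem Pr) inE => /norP[].
have : gcycle e (t :: s :: c :: r).
  rewrite /gcycle 2!cons_uniq in_cons (negPf (sub t tN)) (sub s sN).
  have -> : uniq (c :: r) by move: UC; rewrite -(perm_uniq Pr) => /andP[].
  rewrite orbF !andbT; apply/andP; split.
    by apply: contraTneq st => ->; rewrite e_irr.
  by rewrite /= e_sym st sc rcons_path cr lr e_sym tn.
by move/nC; apply; have := perm_size Pr; rewrite sC /= => <-.
Qed.

(** The orbit form lets positions relative to c be enumerated once d is known. *)
Lemma cycle_traject c : c \in C -> perm_eq (traject (next C) c (size C)) C
  /\ iter (size C) (next C) c = c /\ gcycle e (traject (next C) c (size C)).
Proof.
move=> cC; have [UC CC] := andP GC; have fC := cycle_next UC.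
have E : traject (next C) c (size C) = rot (index c C) C.
  by rewrite -(orbitE fC UC cC) /orbit (order_cycle fC UC cC).
rewrite E perm_rot /gcycle rot_uniq UC rot_cycle CC; split=> //; split=> //.
by rewrite -(order_cycle fC UC cC) (iter_order_cycle fC).
Qed.

Lemma off_edge_hexagon s t c1 c2 : s \notin C -> t \notin C -> e s t ->
  c1 \in C -> e s c1 -> c2 \in C -> e t c2 -> c1 != c2 ->
  d = 3 /\ exists a a1 a2 b b1 b2, [/\ gcycle e [:: a; a1; a2; b; b1; b2],
    perm_eq [:: a; a1; a2; b; b1; b2] C, forall y, e s y = (y \in [:: a; b; t])
    & forall y, e t y = (y \in [:: a; b; s])].
Proof.
move=> sN tN st c1C sc1 c2C tc2 c12; have [UC CC] := andP GC.
have ts : e t s by rewrite e_sym.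
pose X := [set c in C | e s c]; pose Y := [set c in C | e t c].
have Xs y : e s y -> y = t \/ y \in X.
  by move=> sy; case: (off_edge_nbr sN tN st c2C tc2 sy) => h; [left | right; rewrite inE h].
have Yt y : e t y -> y = s \/ y \in Y.
  by move=> ty; case: (off_edge_nbr tN sN ts c1C sc1 ty) => h; [left | right; rewrite inE h].
have card_nbr v v' (V : {set T}) : (forall y, e v y -> y = v' \/ y \in V) -> d <= #|V|.+1.
  move=> H; apply: leq_trans (ex_deg G v) _; rewrite -add1n -(cards1 v').
  apply: leq_trans (subset_leq_card _) (leq_card_setU _ _).1.
  by apply/subsetP => y; rewrite !inE => /H[->|->]; rewrite ?eqxx ?orbT.
have dX := card_nbr _ _ _ Xs; have dY := card_nbr _ _ _ Yt.
pose Z := X :|: Y; pose I := X :&: Y; pose n1 := next C.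
have n1i : injective n1 by apply: can_inj (prev_next UC).
have ZC c : c \in Z -> c \in C by rewrite !inE => /orP[] /andP[].
have nZ c : c \in Z -> n1 c \notin Z.
  rewrite !inE => /orP[] /andP[cC h]; rewrite mem_next cC /= negb_or.
    by rewrite (off_edge_next1 sN cC h) (off_edge_next2 sN tN st cC h).
  by rewrite (off_edge_next1 tN cC h) (off_edge_next2 tN sN ts cC h).
have n2X c : c \in X -> n1 (n1 c) \notin Y.
  by rewrite !inE => /andP[cC h]; rewrite !mem_next cC (off_edge_next3 sN tN st cC h).
have n2Y c : c \in Y -> n1 (n1 c) \notin X.
  by rewrite !inE => /andP[cC h]; rewrite !mem_next cC (off_edge_next3 tN sN ts cC h).
have c1Z : c1 \in X by rewrite inE c1C.
have c2Z : c2 \in Y by rewrite inE c2C.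
have cXY : #|Z| + #|I| = #|X| + #|Y| by rewrite cardsUI.
have IX : #|I| <= #|X| by rewrite subset_leq_card // subsetIl.
have IZ : #|I| <= #|Z| by rewrite (leq_trans IX) // subset_leq_card // subsetUl.
have Z2 : 2 <= #|Z|.
  have <- : #|[set c1; c2]| = 2 by rewrite cards2 c12.
  by apply/subset_leq_card/subsetP => c; rewrite in_set2 inE => /orP[]/eqP->; rewrite ?c1Z ?c2Z ?orbT.
(* Z, its successors and the second successors of I are pairwise disjoint on C. *)
have tot : 2 * #|Z| + #|I| <= d.*2.
  have dis1 : [disjoint Z & n1 @: Z].
    rewrite disjoint_sym disjoints_subset; apply/subsetP => c /imsetP[c' c'Z ->].
    by rewrite inE nZ.
  have dis2 : [disjoint Z :|: n1 @: Z & n1 @: (n1 @: I)].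
    rewrite disjoint_sym disjoints_subset; apply/subsetP => c /imsetP[c' /imsetP[c'' cI ->] ->].
    move: cI; rewrite inE => /andP[cX cY].
    rewrite in_setC in_setU (in_setU _ X) !negb_or n2X // n2Y //=.
    apply/negP => /imsetP[v vZ /n1i E]; have := nZ c''; rewrite E vZ in_setU cX.
    by move=> /(_ isT).
  have : #|(Z :|: n1 @: Z) :|: n1 @: (n1 @: I)| <= size C.
    rewrite -(card_uniqP UC); apply/subset_leq_card/subsetP => c; rewrite in_setU (in_setU c Z).
    case/orP=> [/orP[cZ|]|]; first exact: ZC.
      by case/imsetP=> c' /ZC c'C ->; rewrite mem_next.
    case/imsetP=> c' /imsetP[c'' cI ->] ->; rewrite !mem_next; apply: ZC.
    by move: cI; rewrite inE in_setU => /andP[->].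
  rewrite cardsU (disjoint_setI0 dis2) cards0 subn0 cardsU (disjoint_setI0 dis1) cards0 subn0.
  by rewrite !card_imset // sC; clear; lia.
(* From [2 * #|Z| + #|I| <= 2d] and [#|Z| + #|I| >= 2d - 2] follows [#|Z| <= 2], hence equality, and
   then [#|I| = 2d - 4]. *)
have [cZ di] : #|Z| = 2 /\ #|I| + 4 = d.*2.
  by move: tot Z2 IZ IX cXY dX dY; clear; lia.
have ZE : Z = [set c1; c2].
  apply/esym/eqP; rewrite eqEcard cards2 c12 cZ andbT.
  by apply/subsetP => c; rewrite in_set2 inE => /orP[]/eqP->; rewrite ?c1Z ?c2Z ?orbT.
have [Pt [It Gt]] := cycle_traject c1C.
have c2t : c2 \in traject n1 c1 (size C) by rewrite (perm_mem Pt).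
have nc12 : n1 c1 <> c2 by move=> E; have := nZ c1; rewrite in_setU c1Z E in_setU c2Z orbT => /(_ isT).
have nc21 : n1 c2 <> c1 by move=> E; have := nZ c2; rewrite in_setU c2Z orbT E in_setU c1Z => /(_ isT).
have nnc12 : n1 (n1 c1) <> c2 by move=> E; have := n2X c1 c1Z; rewrite E c2Z.
have nnc21 : n1 (n1 c2) <> c1 by move=> E; have := n2Y c2 c2Z; rewrite E c1Z.
(* I is contained in Z, so 2d - 4 is at most 2. For d = 2 the cycle has four vertices, too few for
   c1 and c2 to be three steps apart in both directions. *)
have [d2|d3] : d = 2 \/ d = 3 by move: di cZ IZ; clear; lia.
  rewrite sC d2 /= in c2t It; rewrite /= !inE eq_sym (negPf c12) /= in c2t.
  by case/or3P: c2t => /eqP E; [case: nc12 | case: nnc12 | case: nc21; rewrite E].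
split=> //; have IE : I = Z by apply/eqP; rewrite eqEcard cZ; apply/andP; split;
  [apply: subset_trans (subsetIl _ _) (subsetUl _ _) | move: di; rewrite d3; clear; lia].
rewrite sC d3 /= in c2t It Pt Gt.
have E : c2 = n1 (n1 (n1 c1)).
  rewrite /= !inE eq_sym (negPf c12) /= in c2t.
  case/or4P: c2t => [/eqP E|/eqP E|/eqP //|/orP[/eqP E|/eqP E]].
  - by case: nc12.
  - by case: nnc12.
  - by case: nnc21; rewrite E.
  - by case: nc21; rewrite E.
have full v v' (V : {set T}) : V \subset Z -> (forall y, e v y -> y = v' \/ y \in V) -> v \notin C ->
    v' \notin C -> e v v' -> forall y, e v y = (y \in [:: c1; c2; v']).
  move=> VZ H vC v'C vv'.
  have Hv y : e v y -> y \in [:: v; c1; c2; v'].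
    case/H => [->|/(subsetP VZ)]; rewrite ?ZE !inE ?eqxx ?orbT //.
    by case/orP=> ->; rewrite ?orbT.
  have := nbrs_full G (mem_head v _) Hv; rewrite d3 => /(_ erefl) fu y.
  apply/idP/idP => [h|h]; first by have := Hv y h; rewrite inE => /orP[/eqP yv|//]; rewrite yv e_irr in h.
  apply: fu; first by rewrite inE h orbT.
  move: h; rewrite !inE => /or3P[]/eqP->; [apply: contraNneq vC|apply: contraNneq vC|] => [<-|<-|] //.
  by apply: contraTneq vv' => ->; rewrite e_irr.
exists c1, (n1 c1), (n1 (n1 c1)), c2, (n1 c2), (n1 (n1 c2)); rewrite E; split=> //.
- by rewrite -E; apply: (full _ _ X) => //; rewrite subsetUl.
- by rewrite -E; apply: (full _ _ Y) => //; rewrite subsetUr.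
Qed.
End Cycle.
End OffEdge.

(** * Twin pairs over two hubs, and the hexagon *)

Definition twins (T : finType) (e : rel T) (a b v v' : T) :=
  [forall y, (e v y == (y \in [:: a; b; v'])) && (e v' y == (y \in [:: a; b; v]))].

Section Twins.
Variables (T : finType) (e : rel T).
Hypothesis e_sym : symmetric e.
Hypothesis e_irr : irreflexive e.

Lemma edge_neq x y : e x y -> x != y.
Proof. by apply: contraTneq => ->; rewrite e_irr. Qed.

Lemma twinsP a b v v' : reflect ((forall y, e v y = (y \in [:: a; b; v'])) /\
  (forall y, e v' y = (y \in [:: a; b; v]))) (twins e a b v v').
Proof.
apply: (iffP forallP) => [H|[H1 H2] y]; last by rewrite H1 H2 !eqxx.
by split=> y; have /andP[/eqP h1 /eqP h2] := H y.
Qed.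

Lemma twinsC a b v v' : twins e a b v v' = twins e a b v' v.
Proof. by apply/twinsP/twinsP => -[]. Qed.

Lemma twins_swap a b v v' : twins e a b v v' = twins e b a v v'.
Proof.
by apply/twinsP/twinsP => -[H1 H2]; split=> y; rewrite ?H1 ?H2 !inE orbCA.
Qed.

Lemma twins_shape a b : a != b ->
  (forall v, v != a -> v != b -> exists v', twins e a b v v') ->
  exists s, #|T| = 2 + 2 * s /\
   ((~~ e a b /\ isomorphic e (joing (emptyg 2) (copiesg s (completeg 2)))) \/
    (e a b /\ isomorphic e (joing (completeg 2) (copiesg s (completeg 2))))).
Proof.
move=> ab H.
have tw v v' : v != a -> v != b -> twins e a b v v' -> [/\ v' != a, v' != b & v' != v].
  move=> va vb /twinsP[H1 H2]; split.
  - by apply: edge_neq; rewrite H2 !inE eqxx.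
  - by apply: edge_neq; rewrite H2 !inE eqxx orbT.
  - by apply: edge_neq; rewrite H2 !inE eqxx !orbT.
pose D := [set v | (v != a) && (v != b)].
have [|s [f [fi fD fe]]] := @clique_classes T e D 2.
  move=> v; rewrite inE => /andP[va vb]; have [v' Hv] := H v va vb.
  have [v'a v'b v'v] := tw v v' va vb Hv; have /twinsP[H1 H2] := Hv.
  exists [set v; v']; split.
  - by rewrite !inE eqxx.
  - by apply/subsetP => x; rewrite !inE => /orP[]/eqP->; apply/andP.
  - by rewrite cards2 eq_sym v'v.
  - move=> x y; rewrite in_set2 inE => xW /andP[ya yb].
    case/orP: xW => /eqP->; rewrite ?H1 ?H2 !inE (negPf ya) (negPf yb) /=.
      by have [->|_] := eqVneq y v; rewrite ?andbT //= (eq_sym v) (negPf v'v).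
    by have [->|_] := eqVneq y v'; rewrite ?orbF ?andbT //= (negPf v'v) andbF.
have fDi i : (f i != a) && (f i != b) by have : f i \in D; [apply/fD; exists i | rewrite inE].
have fab i x : (x == a) || (x == b) -> e (f i) x.
  have /andP[fa fb] := fDi i; have [v' /twinsP[H1 _]] := H _ fa fb.
  by rewrite H1 !inE => /orP[]->; rewrite ?orbT.
pose h (i : 'I_2) := if i == ord0 then a else b.
have hab i : (h i == a) || (h i == b) by rewrite /h; case: ifP; rewrite eqxx ?orbT.
pose g (x : 'I_2 + 'I_s * 'I_2) := match x with inl i => h i | inr q => f q end.
have I2 (i : 'I_2) : i = ord0 \/ i = ord_max.
  by case: i => [[|[|//]] Hi]; [left | right]; apply: val_inj.
have hi : injective h.
  move=> i j; case: (I2 i) (I2 j) => -> [] -> //= E; rewrite /h /= in E;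
    by move: ab; rewrite E eqxx.
have gi : injective g.
  move=> [i|i] [j|j] /= E.
  - by rewrite (hi _ _ E).
  - by have := fDi j; rewrite -E -negb_or hab.
  - by have := fDi i; rewrite E -negb_or hab.
  - by rewrite (fi _ _ E).
have gs x : exists i, g i = x.
  have [->|xa] := eqVneq x a; first by exists (inl ord0).
  have [->|xb] := eqVneq x b; first by exists (inl ord_max).
  have /fD[i <-] : x \in D by rewrite inE xa.
  by exists (inr i).
have gE (e2 : rel 'I_2) : (forall i j, e (h i) (h j) = e2 i j) ->
    forall i j, e (g i) (g j) = joing e2 (copiesg s (completeg 2)) i j.
  move=> he [i|i] [j|j] //=; last by rewrite fab.
  by rewrite e_sym fab.
exists s; split.
  have [_ ->] := @isomorphic_of_param _ _ e (fun i j => e (g i) (g j)) g gi gs (fun _ _ => erefl).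
  by rewrite card_sum card_prod !card_ord mulnC.
have [eab|eab] := boolP (e a b); [right|left]; split=> //.
  have [] // := isomorphic_of_param gi gs (gE (completeg 2) _).
  by move=> i j; case: (I2 i) (I2 j) => -> [] ->; rewrite /h /completeg /= ?e_irr // e_sym.
have [] // := isomorphic_of_param gi gs (gE (emptyg 2) _).
by move=> i j; case: (I2 i) (I2 j) => -> [] ->; rewrite /h /emptyg /= ?e_irr ?(negPf eab) // e_sym (negPf eab).
Qed.

Lemma twins_Km m a b v v' : v != a -> v != b -> a != b -> ~ has_Km e m -> twins e a b v v' ->
  4 <= m /\ (e a b -> 5 <= m).
Proof.
move=> va vb ab nK /twinsP[H1 H2].
have v'a : v' != a by apply: edge_neq; rewrite H2 !inE eqxx.
have v'b : v' != b by apply: edge_neq; rewrite H2 !inE eqxx orbT.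
have v'v : v' != v by apply: edge_neq; rewrite H2 !inE eqxx !orbT.
have cl3 : {in [set a; v; v'] &, forall x y, x != y -> e x y}.
  move=> x y; rewrite !inE -!orbA => /or3P[]/eqP-> /or3P[]/eqP->; rewrite ?eqxx // => _;
    by rewrite ?H1 ?H2 // ?(e_sym a) ?H1 ?H2 !inE eqxx ?orbT.
have c3 : #|[set a; v; v']| = 3.
  by rewrite -setUA cardsU1 cards2 !inE (eq_sym a) (negPf va) (eq_sym a) (negPf v'a) (eq_sym v) v'v.
split=> [|eab]; first by rewrite -c3; exact: clique_lt nK cl3.
have cl4 : {in b |: [set a; v; v'] &, forall x y, x != y -> e x y}.
  move=> x y; rewrite !(in_setU1 _ b) => /orP[/eqP->|xS] /orP[/eqP->|yS]; rewrite ?eqxx // => xy.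
  - by move: yS; rewrite !inE -orbA => /or3P[]/eqP->; rewrite e_sym // ?H1 ?H2 !inE eqxx ?orbT.
  - by move: xS; rewrite !inE -orbA => /or3P[]/eqP->; rewrite // ?H1 ?H2 !inE eqxx ?orbT.
  - exact: cl3.
have := clique_lt nK cl4; rewrite cardsU1 c3 !inE -!orbA (eq_sym b) (negPf ab) (eq_sym b) (negPf vb).
by rewrite (eq_sym b) (negPf v'b).
Qed.
End Twins.

Section Hexagon.
Variables (T : finType) (e : rel T) (p : nat).
Hypothesis G : extremal e 3 p.
Let e_sym := ex_sym G.
Let e_irr := ex_irr G.
Hypothesis pE : p = 8.
Hypothesis nC : forall s, gcycle e s -> size s <> 7.

Definition twin_or_hub a b v := [|| v == a, v == b | [exists v', twins e a b v v']].

Lemma twin_or_hub_nbr a b v y : v != a -> v != b -> twin_or_hub a b v -> e v y ->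
  twin_or_hub a b y.
Proof.
rewrite /twin_or_hub => /negPf-> /negPf-> /= /existsP[v' vv'].
have /twinsP[H1 _] := vv'; rewrite H1 !inE => /or3P[->|->|/eqP->] //; rewrite ?orbT //.
by rewrite (_ : [exists w, _]) ?orbT //; apply/existsP; exists v; rewrite twinsC.
Qed.

(** Degree 3 gives u a neighbour u' that is also outside [twin_or_hub]. The six given vertices with
    u and u' form a path of order 8 = p, so u' sees exactly a, b and u; then the roles can be
    swapped, and u and u' turn out to be twins. *)
Lemma hexagon_hub a a1 a2 b s t u : uniq [:: a; a1; a2; b; s; t] ->
  path e a [:: a1; a2; b; s; t] ->
  {subset [:: a; a1; a2; b; s; t] <= twin_or_hub a b} ->
  ~~ twin_or_hub a b u -> ~~ e a u.
Proof.
move=> U P sub bu; apply/negP => au.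
have bad x y : ~~ twin_or_hub a b x -> e x y -> [|| y == a, y == b | ~~ twin_or_hub a b y].
  move=> bx xy; case: eqVneq => //= ya; case: eqVneq => //= yb.
  by apply: contra bx => gy; apply: twin_or_hub_nbr ya yb gy _; rewrite e_sym.
have bab x : ~~ twin_or_hub a b x -> (x != a) && (x != b).
  by rewrite /twin_or_hub !negb_or => /and3P[-> ->].
have /andP[ua ub] := bab u bu.
have [u' uu' bu'] : exists2 u', e u u' & ~~ twin_or_hub a b u'.
  have [/existsP[u' /andP[]]|/existsPn H] := boolP [exists u', e u u' && ~~ twin_or_hub a b u'].
    by exists u'.
  have := nbrs_size G (mem_head u [:: a; b]).
  suff h y : e u y -> y \in [:: u; a; b] by move/(_ h).
  move=> uy; have := bad u y bu uy; have := H y; rewrite uy /= => /negPf->; rewrite orbF !inE.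
  by move=> ->; rewrite orbT.
have long x y z : ~~ twin_or_hub a b x -> ~~ twin_or_hub a b y -> e a x -> e x y -> e y z ->
    z \in [:: y; a; b; x].
  move=> bx by_ ax xy yz.
  have nin v : ~~ twin_or_hub a b v -> v \notin [:: a; a1; a2; b; s; t] by apply: contra => /sub.
  have A : arms e a [:: a1; a2; b; s; t] [:: x; y].
    apply/armsP; split=> //.
    - by rewrite /= ax xy.
    - rewrite /= !inE !negb_or andbT; have /andP[xa _] := bab x bx; have /andP[ya _] := bab y by_.
      rewrite (eq_sym a) xa (eq_sym a) ya /=.
      by apply: contraTneq xy => ->; rewrite e_irr.
    - move=> v vin; have vin' : v \in [:: a; a1; a2; b; s; t] by rewrite inE vin orbT.
      rewrite !inE negb_or; apply/andP; split; apply: contraTneq vin' => ->; exact: nin.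
  have := longest_arms G A _ yz; rewrite pE => /(_ erefl).
  rewrite -cat_cons mem_cat => /orP[/sub|]; last first.
    by rewrite !inE => /orP[]->; rewrite ?orbT.
  rewrite -[_ \in _]/(twin_or_hub a b z) => gz; have := bad y z by_ yz; rewrite gz orbF !inE => h; by case/orP: h => ->; rewrite ?orbT.
have fullN x y : x != a -> x != b -> y != x -> (forall z, e x z -> z \in [:: x; a; b; y]) ->
    forall z, e x z = (z \in [:: a; b; y]).
  move=> xa xb yx H z; have fu := nbrs_full G (mem_head x _) H erefl.
  apply/idP/idP => h; first by have := H z h; rewrite inE => /orP[/eqP E|//]; rewrite E e_irr in h.
  apply: fu; first by rewrite inE h orbT.
  by move: h; rewrite !inE => /or3P[]/eqP->; rewrite // eq_sym.
have /andP[u'a u'b] := bab u' bu'.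
have u'u : u' != u by apply: contraTneq uu' => ->; rewrite e_irr.
have N' : forall z, e u' z = (z \in [:: a; b; u]).
  by apply: fullN; rewrite // 1?eq_sym // => z; exact: long.
have au' : e a u' by rewrite e_sym N' !inE eqxx.
have N : forall z, e u z = (z \in [:: a; b; u']).
  by apply: fullN => // z; apply: (long u' u) => //; rewrite e_sym.
by move/negP: bu; apply; rewrite /twin_or_hub; apply/or3P/Or33/existsP; exists u'; apply/twinsP.
Qed.

(** Exchanging a1, a2 with s, t gives another hexagon, off which a1 a2 is an edge;
    [off_edge_hexagon] applies to it, and its hubs can only be a and b. *)
Lemma hexagon_twins a a1 a2 b b1 b2 s t : gcycle e [:: a; a1; a2; b; b1; b2] ->
  s \notin [:: a; a1; a2; b; b1; b2] -> t \notin [:: a; a1; a2; b; b1; b2] ->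
  twins e a b s t -> twins e a b a1 a2.
Proof.
move=> GC sN tN /twinsP[H1 H2]; have /andP[U /= ] := GC; rewrite andbT.
move=> /and5P[e1 e2 e3 e4 /andP[e5 e6]].
have st : e s t by rewrite H1 !inE eqxx !orbT.
have nst : s != t by apply: contraTneq st => ->; rewrite e_irr.
move: U sN tN; rewrite /= !inE !negb_or -!andbA andbT.
move=> /and5P[n01 n02 n03 n04 /and5P[n05 n12 n13 n14 /and5P[n15 n23 n24 n25 /and3P[n34 n35 n45]]]].
move=> /and5P[s0 s1 s2 s3 /andP[s4 s5]] /and5P[t0 t1 t2 t3 /andP[t4 t5]].
have GC' : gcycle e [:: a; s; t; b; b1; b2].
  rewrite /gcycle /= !inE !negb_or (eq_sym a) s0 (eq_sym a) t0 n03 n04 n05 nst s3 s4 s5 t3 t4 t5.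
  rewrite n34 n35 n45 /= e4 e5 e6 (e_sym a) H1 !inE eqxx /= st.
  by rewrite H2 !inE eqxx !orbT.
have [] := off_edge_hexagon G pE nC GC' erefl (s := a1) (t := a2) (c1 := a) (c2 := b); rewrite //.
- by rewrite !inE !negb_or (eq_sym a1) n01 (eq_sym a1) s1 (eq_sym a1) t1 n13 n14 n15.
- by rewrite !inE !negb_or (eq_sym a2) n02 (eq_sym a2) s2 (eq_sym a2) t2 n23 n24 n25.
- by rewrite !inE eqxx.
- by rewrite e_sym.
- by rewrite !inE eqxx !orbT.
move=> _ [a' [? [? [b' [? [? [_ _ N1 N2]]]]]]].
have a'a : a \in [:: a'; b'].
  by have := N1 a; rewrite e_sym e1 !inE (negPf n02) orbF => <-.
have b'b : b \in [:: a'; b'].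
  by have := N2 b; rewrite e3 !inE (eq_sym b a1) (negPf n13) orbF => <-.
have ab : [:: a; b] =i [:: a'; b'].
  move=> y; move: a'a b'b n03; rewrite !inE => /orP[]/eqP-> /orP[]/eqP->; rewrite ?eqxx // => _.
  by rewrite orbC.
by apply/twinsP; split=> y; rewrite ?N1 ?N2 !inE !orbA; have := ab y; rewrite !inE => ->.
Qed.

(** The path a, a1, a2, b, s, t and its analogue b, a2, a1, a, t, s let [hexagon_hub] act at both
    hubs. So no edge leaves the set of vertices outside [twin_or_hub], and connectedness empties
    it. *)
Lemma hexagon_all a a1 a2 b b1 b2 s t : gcycle e [:: a; a1; a2; b; b1; b2] ->
  s \notin [:: a; a1; a2; b; b1; b2] -> t \notin [:: a; a1; a2; b; b1; b2] ->
  twins e a b s t -> forall v, twin_or_hub a b v.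
Proof.
move=> GC sN tN tst v.
have GCr : gcycle e [:: b; b1; b2; a; a1; a2].
  move: GC; rewrite /gcycle -(rot_uniq 3) -(rot_cycle 3) //.
have pr : perm_eq [:: b; b1; b2; a; a1; a2] [:: a; a1; a2; b; b1; b2].
  by apply/permPl; exact: (perm_catC [:: b; b1; b2] [:: a; a1; a2]).
have t1 := hexagon_twins GC sN tN tst.
have t2 : twins e a b b1 b2.
  rewrite twins_swap; apply: (hexagon_twins GCr (s := s) (t := t)); rewrite ?(perm_mem pr) //.
  by rewrite twins_swap.
have tw x y : twins e a b x y -> twin_or_hub a b x /\ twin_or_hub a b y.
  move=> h; split; apply/or3P/Or33/existsP; first by exists y.
  by exists x; rewrite twinsC.
have [ga1 ga2] := tw _ _ t1; have [gs gt] := tw _ _ tst.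
have ga : twin_or_hub a b a by rewrite /twin_or_hub eqxx.
have gb : twin_or_hub a b b by rewrite /twin_or_hub eqxx orbT.
have thC x : twin_or_hub a b x = twin_or_hub b a x.
  by rewrite /twin_or_hub orbCA; congr [|| _, _ | _]; apply: eq_existsb => v'; rewrite twins_swap.
have /twinsP[H1 H2] := tst.
have st : e s t by rewrite H1 !inE eqxx !orbT.
have bs : e b s by rewrite e_sym H1 !inE eqxx orbT.
have at_ : e a t by rewrite e_sym H2 !inE eqxx.
have nst : s != t by apply: contraTneq st => ->; rewrite e_irr.
have /andP[U /= ] := GC; rewrite andbT => /and5P[e1 e2 e3 _ _].
have hub1 u : ~~ twin_or_hub a b u -> ~~ e a u.
  apply: (@hexagon_hub a a1 a2 b s t).
  - have : uniq ([:: a; a1; a2; b] ++ [:: s; t]); last by [].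
    rewrite cat_uniq (_ : uniq [:: s; t]) ?andbT; last by rewrite /= inE nst.
    apply/andP; split; first by move: U; rewrite -[_ :: _]/([:: a; a1; a2; b] ++ [:: b1; b2]) cat_uniq => /and3P[].
    apply/hasPn => x; rewrite !inE => /orP[]/eqP->.
      by move: sN; rewrite !inE !negb_or => /and5P[-> -> -> -> _].
    by move: tN; rewrite !inE !negb_or => /and5P[-> -> -> -> _].
  - by rewrite /= e1 e2 e3 bs st.
  - by move=> x; rewrite !inE => /or4P[/eqP->|/eqP->|/eqP->|/or3P[]/eqP->].
have hub2 u : ~~ twin_or_hub a b u -> ~~ e b u.
  rewrite thC; apply: (@hexagon_hub b a2 a1 a t s).
  - have : uniq ([:: b; a2; a1; a] ++ [:: t; s]); last by [].
    rewrite cat_uniq (_ : uniq [:: t; s]) ?andbT; last by rewrite /= inE eq_sym nst.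
    apply/andP; split.
      have := rev_uniq [:: a; a1; a2; b]; rewrite [rev _]/= => ->.
      by move: U; rewrite -[_ :: _]/([:: a; a1; a2; b] ++ [:: b1; b2]) cat_uniq => /and3P[].
    apply/hasPn => x; rewrite !inE => /orP[]/eqP->.
      by move: tN; rewrite !inE !negb_or => /and5P[-> -> -> -> _].
    by move: sN; rewrite !inE !negb_or => /and5P[-> -> -> -> _].
  - by rewrite /= (e_sym b) e3 (e_sym a2) e2 (e_sym a1) e1 at_ e_sym st.
  - by move=> x; rewrite !inE -[_ \in twin_or_hub _ _]/(twin_or_hub b a x) -thC => /or4P[/eqP->|/eqP->|/eqP->|/or3P[]/eqP->].
apply/negPn/negP => bv.
have [||x [y [xB yB xy]]] := @edge_out _ _ _ _ G [set v | ~~ twin_or_hub a b v] v a.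
- by rewrite inE.
- by rewrite inE ga.
rewrite !inE ?negbK in xB yB.
have [ya|ya] := eqVneq y a; first by have := hub1 x xB; rewrite e_sym -ya xy.
have [yb|yb] := eqVneq y b; first by have := hub2 x xB; rewrite e_sym -yb xy.
by move/negP: xB; apply; apply: (twin_or_hub_nbr ya yb yB); rewrite e_sym.
Qed.

End Hexagon.

(** * Assembling the cases *)

Lemma extremal_exists (T : finType) (e : rel T) k d : simple_graph e -> connectedg e ->
  ~ has_Pk e k -> mindeg_ge e d -> 0 < d -> k <= #|T| ->
  exists p, extremal e d p /\ p < k.
Proof.
move=> [e_sym e_irr] conn nP md d0 kT.
have short s : gpath e s -> size s < k.
  move=> /andP[U S]; rewrite ltnNge; apply/negP => ks; apply: nP.
  exists (take k s); split; [by rewrite size_takel | exact: take_uniq |].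
  by move: S; rewrite -{1}(cat_take_drop k s) => /cat_sorted2[].
pose P n := [exists t : n.-tuple T, gpath e t].
have P0 : exists n, P n by exists 0; apply/existsP; exists [tuple].
have Pk n : P n -> n <= k by case/existsP=> t /short; rewrite size_tuple => /ltnW.
case: (ex_maxnP P0 Pk) => p /existsP[t Gt] pmax.
have pk : p < k by have := short t Gt; rewrite size_tuple.
exists p; split=> //; split=> //.
- by move=> s Gs; apply: pmax; apply/existsP; exists (in_tuple s).
- exact: leq_trans pk kT.
- by exists t; rewrite size_tuple.
Qed.

Lemma connected_mindeg (T : finType) (e : rel T) : connectedg e -> 1 < #|T| -> mindeg_ge e 1.
Proof.
move=> conn T1 x; apply/card_gt0P.
have [y yx] : exists y, y != x.
  have := cardsC1 x; have [->|/set0Pn[y]] := eqVneq [set~ x] set0.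
    by rewrite cards0; move: T1; clear; case: #|T| => [|[|n]].
  by rewrite !inE; exists y.
have /connectP[[|z s] /= xs E] := conn x y; first by rewrite E eqxx in yx.
by exists z; rewrite inE; case/andP: xs.
Qed.

(** The subtraction being truncated, [delta k = 0] means [k <= 3]. With at least two vertices the
    minimum degree is at least 1, so [extremal_size] for d = 1 gives a path of order 3. *)
Lemma small_k (T : finType) (e : rel T) k : simple_graph e -> connectedg e ->
  ~ has_Pk e k -> k <= #|T| -> 0 < delta k.
Proof.
move=> sg conn nP kT; rewrite lt0n; apply/negP => /eqP d0.
have k3 : k <= 3 by move: d0; rewrite /delta; clear; lia.
have [T1|T1] := ltnP 1 #|T|.
  have [p [G pk]] := extremal_exists sg conn nP (connected_mindeg conn T1) (ltn0Sn 0) kT.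
  by have := extremal_size G; move: pk k3; clear; lia.
apply: nP; have /orP[/eqP->|/eqP k1] : (k == 0) || (k == 1) by move: kT T1; clear; lia.
  by exists [::].
have /card_gt0P[x _] : 0 < #|T| by rewrite -k1 in kT *; move: kT; rewrite k1.
by exists [:: x]; rewrite k1.
Qed.

(** The excess [size C - 2d] is at most [odd k], so B is empty for k even and has at most two
    vertices for k odd. *)
Lemma long_cycle_subgraph (T : finType) (e : rel T) (k m p : nat) (C : seq T) :
  extremal e (delta k) p -> ~ has_Km e m -> gcycle e C -> (size C).+1 = p ->
  (delta k).*2 <= size C <= (delta k).*2 + odd k ->
  exists H : rel 'I_(delta k), [/\ simple_graph H, ~ has_Km H m.-1 &
       (if ~~ odd k then subgraph_of e (joing H (emptyg (#|T| - delta k)))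
        else subgraph_of e (joing H (uniong (emptyg (#|T| - delta k - 2)) (completeg 2))))].
Proof.
move=> G nK GC sC dC; have d0 := ex_pos G; have pT := ex_card G.
have dC' : (delta k).*2 <= size C <= (delta k).*2.+1.
  by move: dC; case: (odd k); clear; lia.
have [X [B [cX cB XB NX]]] := long_cycle_join G GC sC dC'.
have [v0] : exists v0, v0 \in ~: (X :|: B).
  apply/card_gt0P; have := cardsC (X :|: B); have [+ _] := leq_card_setU X B.
  by move: dC' pT cB; rewrite -sC cX; clear; lia.
rewrite !inE negb_or => /andP[v0X v0B].
have [H [sH nH H0 H2]] := join_subgraph (conj (ex_sym G) (ex_irr G)) nK cX XB NX v0X v0B.
exists H; split=> //; case: (boolP (odd k)) dC => ok /= dC.
  by apply: H2; move: dC' pT cB; rewrite -sC; clear; lia.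
apply: H0; apply/eqP; rewrite -cards_eq0 -leqn0; apply: leq_trans cB _.
by move: dC; clear; lia.
Qed.

Theorem theorem3p1 (k m : nat) (T : finType) (e : rel T) :
  simple_graph e -> connectedg e ->
  ~ has_Pk e k -> ~ has_Km e m ->
  mindeg_ge e (delta k) -> k <= #|T| ->
  let n := #|T| in
  let d := delta k in
  (* (1) *)
  (exists H : rel 'I_d,
     [/\ simple_graph H, ~ has_Km H m.-1 &
       (if ~~ odd k then subgraph_of e (joing H (emptyg (n - d)))
        else subgraph_of e (joing H (uniong (emptyg (n - d - 2)) (completeg 2))))])
  (* (2) *)
  \/ (d + 2 <= m /\
      (isG1 e n k \/ (odd k /\ isG2 e n k) \/ (odd k /\ isG3 e n k m)))
  (* (3) *)
  \/ [/\ k = 7, 4 <= m & isG4 e n \/ isG5 e n]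
  (* (4) *)
  \/ (k = 9 /\ 4 <= m /\
      exists s, n = 2 + 2 * s /\ isomorphic e (joing (emptyg 2) (copiesg s (completeg 2))))
  \/ (k = 9 /\ 5 <= m /\
      exists s, n = 2 + 2 * s /\ isomorphic e (joing (completeg 2) (copiesg s (completeg 2)))).
Proof.
move=> sg conn nP nK md kT n d; have d0 : 0 < d := small_k sg conn nP kT.
have kE : k = d.*2.+2 + odd k by move: d0; rewrite /d /delta; clear; lia.
have [p [G pk]] := extremal_exists sg conn nP md d0 kT.
have [e_sym e_irr] := sg; have dp := extremal_size G.
have [pE|[pE ok]] : p = d.*2.+1 \/ p = d.*2.+2 /\ odd k.
  move: dp pk; rewrite -/d {1}kE; case: (odd k); move: (d); clear; lia.
  have [nc|[x [a [mid [y [b [Gs sz xy lz sm]]]]]]] := noncrossing_or_cycle G.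
    have [c [[v pv] all]] := short_extremal_G1 G nc pE.
    right; left; split; first exact: pendant_Km e_sym nK pv.
    by left; apply: (pendant_G1 e_sym e_irr (c := c)) => //; exists v.
  (* Here [p - 2d = 1], so the crossing cycle has order 2d = p - 1. *)
  have sm1 : size mid = 1 by move: sm; rewrite pE; clear; lia.
  left; apply: long_cycle_subgraph G nK (cross_cycle e_sym Gs xy lz) _ _.
    by move: sz; rewrite !size_cat size_rev sm1 => <-; rewrite /= addSn !addnS.
  by move: sz; rewrite !size_cat size_rev sm1 pE /=; case: (odd k); clear; lia.
have [[C [GC sC]]|nC] := classic (exists s, gcycle e s /\ size s = d.*2.+1).
  by left; apply: (long_cycle_subgraph G nK GC); rewrite sC ?pE // ok addn1 leqnn leqnSn.
have {}nC s : gcycle e s -> size s <> d.*2.+1 by move=> Gs ss; apply: nC; exists s.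
have [nc|[x [a [mid [y [b [Gs sz xy lz sm]]]]]]] := noncrossing_or_cycle G.
  right; have [[c [u [w L]]]|nl] := classic (exists c u w, lollipop e d c u w); last first.
    have [c1 [c2 [cc n12 n21 [[v1 pv1] [v2 pv2]] U0]]] := two_centres G nc pE nl.
    left; split; first exact: pendant_Km e_sym nK pv1.
    right; left; split=> //; apply: (pendant_G2 e_sym e_irr cc) => //; first by exists v1.
    by exists v2.
  have [v pv] := lollipop_pendant G nc pE L.
  have dm : d + 2 <= m := pendant_Km e_sym nK pv.
  have [g3|[d2 g45]] := lollipop_shape G nc pE L nK; first by left; split=> //; right; right.
  right; left; split=> //; first by rewrite kE (d2 : d = 2) ok.
  by move: dm; rewrite (d2 : d = 2).
have GC := cross_cycle e_sym Gs xy lz.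
(* A single omitted vertex would leave a cycle of order 2d + 1, excluded by [nC]; two omitted
   vertices form the edge s t off a cycle of order 2d. *)
have [sm1|sm2] : size mid = 1 \/ size mid = 2 by move: sm; rewrite pE; clear; lia.
  case: (nC _ GC); move: sz; rewrite !size_cat size_rev sm1 pE /=; clear; lia.
case: mid sm2 Gs sz {sm} => [|s [|t [|? ?]]] // _ Gs sz.
set C := (x :: a) ++ rev (y :: b) in GC.
have sC : size C = d.*2.
  by move: sz; rewrite /C !size_cat size_rev pE /=; clear; lia.
have [U S] := andP Gs.
have CE z : (z \in C) = (z \in x :: a) || (z \in y :: b) by rewrite mem_cat mem_rev.
have [sN tN] : s \notin C /\ t \notin C.
  move: U; rewrite cat_uniq => /and3P[_ /hasPn h /= /and3P[]]; rewrite inE negb_or => /andP[_ syb] tyb _.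
  by split; rewrite CE negb_or; apply/andP; split=> //; apply: h; rewrite /= !inE eqxx ?orbT.
have [xs st ty] : [/\ e (last x a) s, e s t & e t y].
  by move: S => /=; rewrite cat_path /= => /and5P[_ -> -> -> _].
have c12 : last x a != y.
  move: U; rewrite cat_uniq => /and3P[_ /hasPn/(_ y) h _].
  have := h; rewrite !inE eqxx !orbT => /(_ isT).
  by apply: contraNneq => <-; rewrite -in_cons mem_last.
have [||||d3 [a0 [a1 [a2 [b0 [b1 [b2 [GH PH N1 N2]]]]]]]] :=
  off_edge_hexagon G pE nC GC sC sN tN st (c1 := last x a) (c2 := y) _ _ _ _ c12.
- by rewrite CE mem_last.
- by rewrite e_sym.
- by rewrite CE mem_head orbT.
- by [].
have tst : twins e a0 b0 s t by apply/twinsP.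
have ab : a0 != b0.
  by move: GH => /andP[/= /and3P[]]; rewrite !inE !negb_or => /and5P[].
have p8 : p = 8 by rewrite pE (d3 : d = 3).
rewrite (d3 : d = 3) in nC; have G3 : extremal e 3 p by rewrite -d3.
have all := hexagon_all G3 p8 nC GH (s := s) (t := t).
rewrite !(perm_mem PH) in all; have {}all := all sN tN tst.
have [r [nr iso]] := twins_shape e_sym e_irr ab (fun v va vb => ltac:(
  by have := all v; rewrite /twin_or_hub (negPf va) (negPf vb) => /existsP)).
have k9 : k = 9 by rewrite kE (d3 : d = 3) ok.
have inH z : z \notin C -> z != a0 /\ z != b0.
  rewrite -(perm_mem PH) !inE !negb_or => /and5P[-> _ _ -> _]; by split.
have [sa sb] := inH s sN.
have [m4 m5] := twins_Km e_sym e_irr sa sb ab nK tst.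
by right; right; right; case: iso => -[eab iso]; [left|right]; split=> //; split; auto; exists r.
Qed.
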